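(* Let $\Gamma$ be a compressed injective labeled oriented tree (LOT). Then the LOT-complex $K(\Gamma)$ is vertex aspherical (VA).
   Context: **Labeled oriented graphs.** A labeled oriented graph (LOG) is a finite oriented graph $\Gamma$ in which each oriented edge is labeled by a vertex of $\Gamma$. The LOG-complex $K(\Gamma)$ is the 2-complex with a single vertex, oriented edges in correspondence with the vertices of $\Gamma$, and 2-cells in correspondence with the edges of $\Gamma$: an edge of $\Gamma$ starting at $x$, ending at $y$ and labeled $z$ gives a 2-cell attached along the word $xz(zy)^{-1}$. A LOG is compressed if no edge is labeled with one of its own end vertices. It is injective if each vertex occurs as an edge label at most once. A LOT is a LOG whose underlying graph is a tree; its complex $K(\Gamma)$ is called the LOT-complex. **Vertex asphericity.** A map of cell complexes is combinatorial if it maps open cells homeomorphically to open cells. A 2-complex is a 2-dimensional cell complex with combinatorial attaching maps. A spherical diagram over a 2-complex $L$ is a combinatorial map $f\colon C\to L$, where $C$ is a 2-sphere with a cell structure. The link $\mathrm{lk}(L,u)$ of a vertex $u$ is the boundary of a regular neighborhood of $u$; it is a graph whose edges are the corners of 2-cells at $u$. For a vertex $v\in C$, $f$ induces a combinatorial map $\mathrm{lk}(C,v)\to \mathrm{lk}(L,f(v))$, whose image is a closed edge path $z(v)=c_1\ldots c_q$ in $\mathrm{lk}(L,f(v))$. A closed edge path $e_1\ldots e_q$, read cyclically, is homology reduced if it contains no pair $e_i,e_j$ with $e_i=\bar e_j$ (bar denotes opposite orientation). The vertex $v$ is a folding vertex if $z(v)$ is not homology reduced. $L$ is vertex aspherical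 (VA) if every spherical diagram over $L$ has a folding vertex. *)

(* Defs.v *)
From mathcomp Require Import all_fingroup all_boot.

Set Implicit Arguments.
Unset Strict Implicit.
Unset Printing Implicit Defensive.

Record ograph (V E : Type) := OGraph { src : E -> V; tgt : E -> V }.

(** An oriented edge [(e, b)] is [e] with its given orientation if [b = true],
    and with the opposite orientation if [b = false]. *)
Definition ebar (E : Type) (a : E * bool) : E * bool := (a.1, ~~ a.2).

Definition wbar (E : Type) (w : seq (E * bool)) : seq (E * bool) :=
  rev (map (@ebar E) w).

Definition esrc (V E : Type) (g : ograph V E) (a : E * bool) : V :=
  if a.2 then src g a.1 else tgt g a.1.

Definition etgt (V E : Type) (g : ograph V E) (a : E * bool) : V :=
  esrc g (ebar a).

Definition follows (V : eqType) (E : Type) (g : ograph V E) : rel (E * bool) :=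
  fun a b => etgt g a == esrc g b.

(** [cycle (follows g) p] says that [p] is a closed edge path; such a [p] is a
    circuit if it is nonempty and repeats neither a vertex nor an edge (this
    covers loops and pairs of parallel edges). *)
Definition circuit (V E : eqType) (g : ograph V E) (p : seq (E * bool)) : bool :=
  [&& p != [::], cycle (follows g) p, uniq (map (esrc g) p) & uniq (map fst p)].

Definition adjacent (V E : finType) (g : ograph V E) : rel V :=
  fun x y => [exists a : E * bool, (esrc g a == x) && (etgt g a == y)].

Definition is_tree (V E : finType) (g : ograph V E) : Prop :=
  [/\ 0 < #|V|,
      forall x y : V, connect (adjacent g) x y
    & forall p : seq (E * bool), ~~ circuit g p].

(** The 2-cell [c] is a polygon attached along the closed edge path [bdry c]. *)
Record complex2 := Complex2 {
  cvert : eqType;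
  cedge : eqType;
  cell : eqType;
  skel : ograph cvert cedge;
  bdry : cell -> seq (cedge * bool);
  bdry_neq0 : forall c : cell, bdry c != [::];
  bdry_closed : forall c : cell, cycle (follows skel) (bdry c)
}.

(** The [i]-th side of the polygon [c].  The same type indexes the corners of the
    polygons: the [i]-th corner is the one at the starting point of the [i]-th
    side, between the sides [i - 1] and [i] (cyclically). *)
Definition side (L : complex2) : Type := {c : cell L & 'I_(size (bdry c))}.

Definition cell_of (L : complex2) (s : side L) : cell L := tag s.

Definition letter (L : complex2) (s : side L) : cedge L * bool :=
  tnth (in_tuple (bdry (tag s))) (tagged s).

Definition side_succ (L : complex2) (s : side L) : side L :=
  existT (fun c : cell L => 'I_(size (bdry c))) (tag s) (ordS (tagged s)).

Definition side_pred (L : complex2) (s : side L) : side L :=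
  existT (fun c : cell L => 'I_(size (bdry c))) (tag s) (ord_pred (tagged s)).

(** The vertices of the link [lk(L, u)] are the oriented edges of [L] starting at
    [u]; its edges are the corners at [u].  An oriented corner [(s, true)] runs
    from the side leaving the corner [s] to the reverse of the side entering it,
    and [(s, false)] runs the opposite way.  All links of [L] are treated at
    once: an oriented corner [e] lies in the link of [esrc (skel L) (lk_src e)]. *)
Definition corner (L : complex2) : eqType := (side L * bool)%type.

Definition cbar (L : complex2) (e : corner L) : corner L := (e.1, ~~ e.2).

Definition lk_src (L : complex2) (e : corner L) : cedge L * bool :=
  if e.2 then letter e.1 else ebar (letter (side_pred e.1)).

Definition lk_tgt (L : complex2) (e : corner L) : cedge L * bool :=
  lk_src (cbar e).

Definition homology_reduced (L : complex2) (z : seq (corner L)) : Prop :=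
  forall e e' : corner L, e \in z -> e' \in z -> e <> cbar e'.

(** A cell structure on the oriented 2-sphere, as a combinatorial map: darts are
    the oriented edges, [opp] reverses them, and [fnext a] is the edge following
    [a] on the boundary of the face to the left of [a].  Faces and edges are the
    orbits of [fnext] and [opp].  Vertices are the orbits of [vnext], which takes
    an edge [a] to the next edge, counterclockwise, with the same starting point.
    A closed connected surface is a sphere iff its Euler characteristic is 2. *)
Definition vnext_of (D : finType) (opp fnext : {perm D}) : {perm D} :=
  (fnext^-1 * opp)%g.

Record sphere := Sphere {
  dart : finType;
  opp : {perm dart};
  fnext : {perm dart};
  oppK : involutive opp;
  opp_neq : forall a : dart, opp a != a;
  sphere_connected : forall a b : dart,
    connect (fun x y => (y == opp x) || (y == fnext x)) a b;
  sphere_euler :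
    #|porbits (vnext_of opp fnext)| + #|porbits fnext| = #|porbits opp| + 2
}.

Definition vnext (C : sphere) : {perm dart C} := vnext_of (opp C) (fnext C).

(** A combinatorial map [C -> L]: [dedge a] is the image of the oriented edge [a].
    The face to the left of [a] is sent to the 2-cell [cell_of (dside a)], with
    [a] on its boundary going to the side [dside a]; [dsign a] tells whether the
    boundary of that face is read along [bdry] or against it.  The face is mapped
    homeomorphically, so its boundary has the same length as that of its image.
    The images of the vertices are determined by those of the edges. *)
Record diagram (C : sphere) (L : complex2) := Diagram {
  dedge : dart C -> cedge L * bool;
  dside : dart C -> side L;
  dsign : dart C -> bool;
  dedge_opp : forall a, dedge (opp C a) = ebar (dedge a);
  dedge_side : forall a,
    dedge a = if dsign a then letter (dside a) else ebar (letter (dside a));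
  dsign_next : forall a, dsign (fnext C a) = dsign a;
  dside_next : forall a, dside (fnext C a) =
    if dsign a then side_succ (dside a) else side_pred (dside a);
  dface_size : forall a,
    #|porbit (fnext C) a| = size (bdry (cell_of (dside a)))
}.

(** The corner of [C] at the starting point of [a] lying to the left of [a] runs
    from [a] to [vnext a] in the link; this is its image. *)
Definition dcorner (C : sphere) (L : complex2) (f : diagram C L) (a : dart C)
    : corner L :=
  if dsign f a then (dside f a, true) else (side_succ (dside f a), false).

(** The closed path [z(v)], where [v] is the starting point of [a]. *)
Definition link_path (C : sphere) (L : complex2) (f : diagram C L) (a : dart C)
    : seq (corner L) :=
  map (dcorner f) (traject (vnext C) a #|porbit (vnext C) a|).

Definition folding (C : sphere) (L : complex2) (f : diagram C L) (a : dart C)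
    : Prop := ~ homology_reduced (link_path f a).

Definition vertex_aspherical (L : complex2) : Prop :=
  forall (C : sphere) (f : diagram C L), exists a : dart C, folding f a.

Lemma ebarK (E : Type) : involutive (@ebar E).
Proof. by case=> e b; rewrite /ebar /= negbK. Qed.

Lemma side_predK (L : complex2) : cancel (@side_pred L) (@side_succ L).
Proof. by case=> c i; rewrite /side_succ /side_pred /= ord_predK. Qed.

Lemma side_succK (L : complex2) : cancel (@side_succ L) (@side_pred L).
Proof. by case=> c i; rewrite /side_succ /side_pred /= ordSK. Qed.

Lemma lk_src_dcorner (C : sphere) (L : complex2) (f : diagram C L) (a : dart C) :
  lk_src (dcorner f a) = dedge f a.
Proof.
rewrite dedge_side /dcorner /lk_src; case: (dsign f a) => //=.
by rewrite side_succK.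
Qed.

Lemma lk_tgt_dcorner (C : sphere) (L : complex2) (f : diagram C L) (a : dart C) :
  lk_tgt (dcorner f a) = dedge f (vnext C a).
Proof.
rewrite /vnext permM dedge_opp.
set b := ((fnext C)^-1)%g a; have -> : a = fnext C b by rewrite permKV.
rewrite dedge_side /dcorner /lk_tgt /lk_src /cbar dsign_next dside_next.
by case: (dsign f b) => /=; rewrite ?side_succK ?side_predK ?ebarK.
Qed.

Lemma link_path_closed (C : sphere) (L : complex2) (f : diagram C L)
    (a : dart C) :
  cycle (fun e e' => lk_tgt e == lk_src e') (link_path f a).
Proof.
rewrite /link_path cycle_map.
apply: (@sub_cycle _ (frel (vnext C))).
  by move=> x y /= /eqP <-; rewrite lk_tgt_dcorner lk_src_dcorner.
case E : #|porbit (vnext C) a| => [|n] //=.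
rewrite rcons_path fpath_traject last_traject /=.
by rewrite -iterS -E iter_porbit.
Qed.

Record LOG := MkLOG {
  lvert : finType;
  ledge : finType;
  lgraph : ograph lvert ledge;
  label : ledge -> lvert
}.

Definition is_LOT (G : LOG) : Prop := is_tree (lgraph G).

Definition compressed (G : LOG) : Prop :=
  forall e : ledge G, label e <> src (lgraph G) e /\ label e <> tgt (lgraph G) e.

Definition label_injective (G : LOG) : Prop := injective (@label G).

(** The word [xz(zy)^-1] of an edge from [x] to [y] labeled [z]. *)
Definition LOG_word (G : LOG) (e : ledge G) : seq (lvert G * bool) :=
  let x := (src (lgraph G) e, true) in
  let y := (tgt (lgraph G) e, true) in
  let z := (label e, true) in
  [:: x; z] ++ wbar [:: z; y].

Definition LOG_skel (G : LOG) : ograph unit (lvert G) :=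
  OGraph (fun=> tt) (fun=> tt).

Lemma LOG_word_neq0 (G : LOG) (e : ledge G) : LOG_word e != [::].
Proof. by []. Qed.

Lemma LOG_word_closed (G : LOG) (e : ledge G) :
  cycle (follows (LOG_skel G)) (LOG_word e).
Proof. by []. Qed.

Definition LOG_complex (G : LOG) : complex2 :=
  Complex2 (@LOG_word_neq0 G) (@LOG_word_closed G).

(* Main.v *)
From mathcomp Require Import all_boot all_order all_fingroup all_algebra.
From mathcomp Require Import zify ring lra.
Require Import Defs.

(** A spherical diagram without folding vertices carries a height function (the
    sphere has no first cohomology), rising by 1 along every positively oriented
    edge.  Take the smallest sub-LOT [T] that contains all its cells and a
    coarsest partition of [T] into at least two sub-LOTs; a cell is inner if its
    edge of [T] lies in one block.

    If there are only two blocks, a single edge joins them, and a highest corner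
    of its cell on the side of the block without its label leads to a folding
    vertex.  Otherwise, by Edmonds' theorem on disjoint arborescences (injectivity
    gives each block but one exactly two outgoing arcs, from its label to the two
    ends of the labeled edge, and coarseness gives the cut condition), the blocks
    have signs such that colouring each oriented edge by its sign times the sign
    of its block makes both monochromatic parts of the link acyclic modulo the
    blocks.  Hence around every vertex that meets an outer cell the colour changes
    at least twice, where a maximal run of inner corners counts as one step.  On
    the other hand the inner region has Euler characteristic at most the number of
    its boundary corners whose two edges both go down, because each component has
    one at its highest boundary point; the same holds for going up.  Together this
    contradicts Euler's formula, so there is no outer cell, all cells lie in one
    block, and [T] was not minimal. *)

Set Implicit Arguments.
Unset Strict Implicit.
Unset Printing Implicit Defensive.
Import Order.TTheory GRing.Theory Num.Theory.
Local Open Scope ring_scope.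

(** * Underdetermined linear systems *)

Section Kernel.
Variables (K : fieldType) (TX TJ TI TS : finType).
Variables (X : {set TX}) (J : {set TJ}) (I : {set TI}) (S : {set TS}).
Variables (z : TX -> TJ -> K) (n : TJ -> TI -> K) (s : TS -> TI -> K).

Lemma enum_extend (T : finType) (A : {set T}) (p : 'rV[K]_#|A|) :
  exists u : T -> K, forall i, u (enum_val i) = p 0 i.
Proof.
case: (set_0Vmem A) => [A0 | [x0 x0A]].
  exists (fun=> 0) => i; suff: enum_val i \in set0 by rewrite inE.
  by rewrite -A0 enum_valP.
by exists (fun x => p 0 (enum_rank_in x0A x)) => i; rewrite enum_valK_in.
Qed.

(* [n] are the coefficients of the equations, [z] those of independent relations between them. *)
Lemma kernel_exists :
  (forall x i, x \in X -> i \in I -> \sum_(j in J) z x j * n j i = 0) ->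
  (forall psi : TX -> K,
     (forall j, j \in J -> \sum_(x in X) psi x * z x j = 0) ->
     forall x, x \in X -> psi x = 0) ->
  (#|J| + #|S| < #|X| + #|I|)%N ->
  exists u : TI -> K,
    [/\ forall j, j \in J -> \sum_(i in I) n j i * u i = 0,
        forall t, t \in S -> \sum_(i in I) s t i * u i = 0
      & exists2 i, i \in I & u i != 0].
Proof.
move=> Hrel Hind Hlt.
pose Z : 'M[K]_(#|J|, #|X|) := \matrix_(j, x) z (enum_val x) (enum_val j).
pose N : 'M[K]_(#|I|, #|J|) := \matrix_(i, j) n (enum_val j) (enum_val i).
pose E : 'M[K]_(#|I|, #|S|) := \matrix_(i, t) s (enum_val t) (enum_val i).
have NZ : N *m Z = 0.
  apply/matrixP=> i x; rewrite !mxE.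
  rewrite -[RHS](Hrel _ _ (enum_valP x) (enum_valP i)) [RHS]big_enum_val.
  by apply: eq_bigr => j _; rewrite !mxE mulrC.
have rkZ : \rank Z = #|X|.
  rewrite -mxrank_tr; apply/eqP; rewrite -[_ == _]/(row_free _) -kermx_eq0.
  apply/rowV0P => p /sub_kermxP pZ.
  have [psi psiE] := enum_extend p.
  apply/rowP=> i; rewrite mxE -psiE; apply: Hind (enum_valP i) => j jJ.
  move/rowP/(_ (enum_rank_in jJ j)): pZ; rewrite !mxE => h0.
  rewrite -[RHS]h0 [LHS]big_enum_val; apply: eq_bigr => x _.
  by rewrite !mxE psiE enum_rankK_in.
(* The [#|X|] independent relations lower the rank of the equations to at most [#|J| - #|X|], so
   together with the [#|S|] extra conditions the rank stays below the number of unknowns. *)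
have rkN : (\rank N + #|X| <= #|J|)%N by rewrite -rkZ mulmx0_rank_max.
have rkM : (\rank (row_mx N E) < #|I|)%N.
  have h : (\rank (row_mx N E) <= \rank N + \rank E)%N.
    rewrite -mxrank_tr tr_row_mx -addsmxE.
    by rewrite -(mxrank_tr N) -(mxrank_tr E) mxrank_adds_leqif.
  have hE := rank_leq_col E.
  by rewrite -(ltn_add2l #|X|) (leq_ltn_trans _ Hlt) //; lia.
have /rowV0Pn[p /sub_kermxP pM p0] : kermx (row_mx N E) != 0.
  by rewrite kermx_eq0 /row_free ltn_eqF.
have [u uE] := enum_extend p.
move/eqP: pM; rewrite mul_mx_row -[0]row_mx0 => /eqP/eq_row_mx[pN pE].
exists u; split=> [j jJ | t tS |].
- move/rowP/(_ (enum_rank_in jJ j)): pN; rewrite !mxE => h0.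
  rewrite -[RHS]h0 [LHS]big_enum_val; apply: eq_bigr => i _.
  by rewrite !mxE uE enum_rankK_in // mulrC.
- move/rowP/(_ (enum_rank_in tS t)): pE; rewrite !mxE => h0.
  rewrite -[RHS]h0 [LHS]big_enum_val; apply: eq_bigr => i _.
  by rewrite !mxE uE enum_rankK_in // mulrC.
have /existsP[i pi] : [exists i, p 0 i != 0].
  apply: contraNT p0 => /existsPn p0; apply/eqP/rowP=> i.
  by rewrite mxE; apply/eqP; have := p0 i; rewrite negbK.
by exists (enum_val i); rewrite ?enum_valP // uE.
Qed.
End Kernel.

(** * Spheres *)

Section Porbit.
Variables (D : finType) (s : {perm D}).

Lemma porbit_stepE a : porbit s (s a) = porbit s a.
Proof. by have := porbit_perm s 1 a; rewrite expg1. Qed.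

Lemma mem_porbit_step a b : (s a \in porbit s b) = (a \in porbit s b).
Proof. by rewrite -!eq_porbit_mem porbit_stepE. Qed.

Lemma porbits_stepE X a : X \in porbits s -> (s a \in X) = (a \in X).
Proof. by case/imsetP=> b _ ->; apply: mem_porbit_step. Qed.

Lemma porbits_mem X a : X \in porbits s -> (a \in X) = (X == porbit s a).
Proof. by case/imsetP=> b _ ->; rewrite eq_sym eq_porbit_mem. Qed.

Lemma mem_porbits a : porbit s a \in porbits s.
Proof. exact: imset_f. Qed.

Lemma sum_porbits_shift (V : zmodType) (X : {set D}) (g : D -> V) :
  X \in porbits s -> \sum_(a in X) (g (s a) - g a) = 0.
Proof.
move=> Xs; rewrite big_split sumrN /= [X in X - _](_ : _ = \sum_(a in X) g a) ?subrr //.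
rewrite [RHS](reindex_inj (@perm_inj _ s)) /=.
by apply: eq_bigl => a; rewrite porbits_stepE.
Qed.

Lemma porbit_iter_ind (P : pred D) a b :
  (forall x, P x -> P (s x)) -> P a -> b \in porbit s a -> P b.
Proof.
move=> Ps Pa /porbitP[i ->]; elim: i => [|i IH]; first by rewrite expg0 perm1.
by rewrite expgSr permM Ps.
Qed.

(** Turns the coefficient sums of the linear systems below into the value at [a] of [psi], extended
    by zero to the orbits outside [X]. *)
Lemma sum_indicator (K : pzRingType) (X : {set {set D}}) (psi : {set D} -> K) a :
  X \subset porbits s ->
  \sum_(x in X) psi x * (a \in x)%:R = if porbit s a \in X then psi (porbit s a) else 0.
Proof.
move=> /subsetP Xs; case: ifP => aX.
  rewrite (bigD1 (porbit s a)) //= porbit_id mulr1 big1 ?addr0 // => x /andP[xX xa].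
  by rewrite (porbits_mem _ (Xs _ xX)) (negbTE xa) mulr0.
rewrite big1 // => x xX; rewrite (porbits_mem _ (Xs _ xX)).
by case: eqP xX aX => [-> ->|] //; rewrite mulr0.
Qed.

End Porbit.

(** * Potentials on the sphere *)

Section SphereFacts.
Variable C : sphere.
Local Notation D := (dart C).
Local Notation v := (vnext C).
Local Notation fn := (fnext C).
Local Notation op := (opp C).

Lemma vnext_fnext a : v (fn a) = op a.
Proof. by rewrite permM permK. Qed.

Lemma vnextE a : exists2 b, a = fn b & v a = op b.
Proof. by exists ((fn^-1)%g a); rewrite ?permM // permKV. Qed.

Lemma sphere_all (P : pred D) :
  (forall a, P a -> P (op a)) -> (forall a, P a -> P (fn a)) ->
  forall a b, P a -> P b.
Proof.
move=> Po Pf a b Pa; have /connectP[p] := sphere_connected a b.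
elim: p a Pa => [|c p IH] a Pa /= => [_ -> //|/andP[ac cp]].
by apply: IH => //; case/orP: ac => /eqP->; auto.
Qed.

Lemma porbit_opp a : porbit op a = [set a; op a].
Proof.
apply/setP=> b; rewrite !inE; apply/idP/idP; last first.
  by case/orP=> /eqP->; rewrite ?mem_porbit_step porbit_id.
apply: (@porbit_iter_ind _ op (fun b => (b == a) || (b == op a))); last by rewrite eqxx.
by move=> x /orP[] /eqP ->; rewrite ?oppK eqxx ?orbT.
Qed.

Section Half.
Variable pos : pred D.
Hypothesis pos_opp : forall a, pos (op a) = ~~ pos a.

Lemma card_edges : #|porbits op| = #|[set a | pos a]|.
Proof.
rewrite /porbits; have -> : [set porbit op x | x : D] = porbit op @: [set a | pos a].
  apply/setP=> X; apply/imsetP/imsetP=> -[a aP ->]; last by exists a.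
  case: (boolP (pos a)) => pa; first by exists a; rewrite ?inE.
  by exists (op a); rewrite ?inE ?pos_opp // porbit_stepE.
rewrite card_in_imset // => a b; rewrite !inE => pa pb /eqP.
rewrite eq_porbit_mem porbit_opp !inE => /orP[] /eqP // ab.
by move: pa; rewrite ab pos_opp pb.
Qed.

Lemma sum_half (R : pred D) (V : zmodType) (g : D -> V) :
  (forall a, R (op a) = R a) ->
  \sum_(a | R a) g a = \sum_(a in [set a | pos a && R a]) (g a + g (op a)).
Proof.
move=> Ro; rewrite big_split /= (bigID pos) /=; congr (_ + _).
  by apply: eq_bigl => a; rewrite inE andbC.
rewrite (reindex_inj (@perm_inj _ op)) /=; apply: eq_bigl => a.
by rewrite inE Ro pos_opp negbK andbC.
Qed.

(** The product expands into one term for each orientation of the edge. The resulting sum over darts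
    can be regrouped around a vertex or a face. *)
Lemma sum_half_prod (R : pred D) (V : comPzRingType) (p q : D -> V) :
  (forall a, R (op a) = R a) ->
  \sum_(a in [set a | pos a && R a]) (p a - p (op a)) * (q a - q (op a)) =
  \sum_(a | R a) p a * (q a - q (op a)).
Proof.
move=> Ro; rewrite (sum_half _ Ro); apply: eq_bigr => a _.
by rewrite oppK; ring.
Qed.

Lemma card_half (R : pred D) : (forall a, R (op a) = R a) ->
  #|[set a | R a]| = (#|[set a | pos a && R a]|).*2.
Proof.
move=> Ro; rewrite -addnn -(cardsID [set a | pos a] [set a | R a]).
congr (_ + _)%N; first by apply: eq_card => a; rewrite !inE andbC.
rewrite -(card_imset _ (@perm_inj _ op)); apply: eq_card => a.
rewrite -{1}[a](oppK) (mem_imset _ _ (@perm_inj _ op)) !inE pos_opp negbK.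
by rewrite Ro.
Qed.

Lemma sphere_dart : exists d : D, true.
Proof.
case: (pickP D) => [d _|D0]; first by exists d.
have le (s : {perm D}) : (#|porbits s| <= #|D|)%N by apply: leq_imset_card.
have := sphere_euler C; have := le (vnext C); have := le fn; rewrite /vnext.
by rewrite (eq_card0 D0); lia.
Qed.

(** The vanishing of the first cohomology of the sphere, by counting dimensions: the unknowns are
    the values at the vertices and a scaling factor [t], the equations ask for difference [w * t]
    along each edge, and all faces but one give independent relations. *)
Lemma sphere_exact (w : D -> rat) :
  (forall a, w (op a) = - w a) ->
  (forall X, X \in porbits fn -> \sum_(a in X) w a = 0) ->
  exists h : D -> rat, forall a, h (v a) = h a /\ h (op a) - h a = w a.
Proof.
move=> wo wf; have [d _] := sphere_dart.
pose X := porbits fn :\ porbit fn d.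
pose J := [set a | pos a && true].
(* [None] is the unknown [t]; the single condition [s] normalizes the potential to be 0 at the start
   of [d]. *)
pose I := None |: (Some @: porbits v).
pose z (x : {set D}) (j : D) : rat := (j \in x)%:R - (op j \in x)%:R.
pose n (j : D) (i : option {set D}) : rat := if i is Some x then (op j \in x)%:R - (j \in x)%:R else - w j.
pose s (_ : unit) (i : option {set D}) : rat := (i == Some (porbit v d))%:R.
have Isum (g : option {set D} -> rat) :
    \sum_(i in I) g i = g None + \sum_(x in porbits v) g (Some x).
  rewrite big_setU1 /=; last by apply/imsetP=> -[].
  by rewrite big_imset //= => x y _ _ [].
have cI : #|I| = (#|porbits v|).+1.
  rewrite cardsU1 card_imset; last by move=> x y [].
  by rewrite (_ : None \notin _) //; apply/imsetP=> -[].
have cX : #|porbits fn| = (#|X|).+1 by rewrite (cardsD1 (porbit fn d)) mem_porbits.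
have opX a x : x \in porbits v -> (op a \in x) = (fn a \in x).
  by move=> xv; rewrite -vnext_fnext porbits_stepE.
have [|||u [uJ uS [i iI ui]]] := @kernel_exists rat _ _ _ _ X J I [set tt] z n s.
- move=> x i /setD1P[_ xf] iI.
  have R1 (g : D -> rat) : (forall a, g (op a) = - g a) ->
      \sum_(j in J) z x j * g j = \sum_(a in x) g a.
    move=> go; rewrite [RHS]big_mkcond /= (@sum_half xpredT) //.
    by apply: eq_bigr => j _; rewrite /z go; do 2!case: ifP => _ /=; ring.
  rewrite R1; last by move=> a; case: i iI => [y|] _ /=; rewrite ?wo ?oppK ?opprB.
  case: i iI => [y|] iI /=; last by rewrite sumrN wf // oppr0.
  move: iI; rewrite !inE /= mem_imset; last by move=> ? ? [].
  move=> yv; rewrite -[RHS](sum_porbits_shift (fun a => (a \in y)%:R : rat) xf).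
  by apply: eq_bigr => a _; rewrite opX.
(* A dependency is a function on faces that agrees across every edge and vanishes on the omitted
   face, hence everywhere. *)
- move=> psi Hpsi.
  pose P a := if porbit fn a \in X then psi (porbit fn a) else 0.
  have sX : X \subset porbits fn by apply: subsetDl.
  have Pf a : P (fn a) = P a by rewrite /P porbit_stepE.
  have Ppos a : pos a -> P (op a) = P a.
    move=> pa; have := Hpsi a; rewrite inE pa => /(_ isT).
    under eq_bigr do rewrite mulrBr.
    by rewrite sumrB !(@sum_indicator _ fn) // -/(P _) -/(P _) => /subr0_eq.
  have Po a : P (op a) = P a.
    case: (boolP (pos a)) => [/Ppos //|na].
    by have := Ppos (op a); rewrite pos_opp oppK => /(_ na) ->.
  have P0 : P d == 0 by rewrite /P !inE eqxx.
  move=> x xX; have /imsetP[a _ xa] := subsetP sX x xX.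
  have : P a == 0 by apply: (@sphere_all (fun a => P a == 0)) P0 => b; rewrite ?Po ?Pf.
  by rewrite /P -xa xX => /eqP.
- have EJ : #|J| = #|[set a | pos a]| by apply: eq_card => a; rewrite !inE andbT.
  (* With Euler characteristic 2 the unknowns and relations outnumber the equations and the
     normalization by exactly one. *)
  have := sphere_euler C; rewrite card_edges -[vnext_of _ _]/v cX EJ cards1 cI.
  by lia.
pose t := u None; pose H a := u (Some (porbit v a)).
have HE a : H (op a) - H a = w a * t.
  have Hpos b : pos b -> H (op b) - H b = w b * t.
    move=> pb; have := uJ b; rewrite inE pb => /(_ isT); rewrite Isum /=.
    under eq_bigr do rewrite mulrC mulrBr.
    rewrite sumrB !(@sum_indicator _ v _ _ (fun x => u (Some x))) // !mem_porbits.
    by rewrite -/(H _) -/(H _) -/t => /eqP; rewrite mulNr addrC subr_eq0 => /eqP.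
  case: (boolP (pos a)) => [/Hpos //|na].
  by have := Hpos (op a); rewrite pos_opp oppK wo => /(_ na) h; rewrite -opprB h; ring.
have Hv a : H (v a) = H a by rewrite /H porbit_stepE.
(* If [t] were 0, then [H] would be constant, hence zero by the normalization, and the whole
   solution would vanish. *)
have t0 : t != 0.
  apply: contraNneq ui => t0.
  have Ho a : H (op a) = H a by apply/subr0_eq; rewrite HE t0 mulr0.
  have Hf a : H (fn a) = H a by rewrite -Hv vnext_fnext Ho.
  have Hd : H d == 0.
    have := uS tt; rewrite inE => /(_ (eqxx _)); rewrite Isum /s /= mul0r add0r.
    rewrite (bigD1 (porbit v d)) ?mem_porbits //= eqxx mul1r big1 ?addr0 => [/eqP //|x].
    by case/andP=> _ xd; rewrite (inj_eq Some_inj) (negbTE xd) mul0r.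
  move: iI; rewrite !inE; case/orP=> [/eqP->|/imsetP[x /imsetP[a _ ->] ->]].
    by rewrite -/t t0.
  by apply: (@sphere_all (fun a => H a == 0)) Hd => b; rewrite ?Ho ?Hf.
exists (fun a => H a / t) => a; rewrite Hv; split=> //.
by rewrite -mulrBl HE mulfK.
Qed.
End Half.
End SphereFacts.

(** * The region of inner faces *)

Section Arcs.
Variables (D : finType) (s : {perm D}) (inn : pred D).

(** The first iterate of [a], possibly [a] itself, outside [inn]; the default [a] is taken only if
    the orbit lies in [inn]. For [s = vnext] it is the edge at which a run of inner corners ends. *)
Definition arcend a :=
  if [pick k : 'I_#|D| | ~~ inn (iter k s a) && [forall j : 'I_k, inn (iter j s a)]]
    is Some k then iter k s a else a.

Definition has_out a := [exists b in porbit s a, ~~ inn b].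

Lemma has_out_step a : has_out (s a) = has_out a.
Proof. by rewrite /has_out porbit_stepE. Qed.

Lemma out_has_out a : ~~ inn a -> has_out a.
Proof. by move=> na; apply/existsP; exists a; rewrite porbit_id. Qed.

Lemma has_outP a :
  reflect (exists2 k, ~~ inn (iter k s a) & forall j, (j < k)%N -> inn (iter j s a)) (has_out a).
Proof.
apply: (iffP existsP) => [[b /andP[/porbitP[i ->] nb]]|[k nk _]]; last first.
  by exists (iter k s a); rewrite nk andbT -permX mem_porbit.
have ex : exists k, ~~ inn (iter k s a) by exists i; rewrite -permX.
exists (ex_minn ex); case: ex_minnP => // k _ kmin j jk.
by apply: contraTT jk => /kmin; rewrite -leqNgt.
Qed.

Lemma arcendE a k : ~~ inn (iter k s a) -> (forall j, (j < k)%N -> inn (iter j s a)) ->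
  arcend a = iter k s a.
Proof.
move=> nk kmin; have kD : (k < #|D|)%N.
  apply: leq_trans (max_card (porbit s a)); rewrite ltnNge; apply/negP => le.
  have m0 : (0 < #|porbit s a|)%N by rewrite lt0n card_porbit_neq0.
  have e : iter k s a = iter (k - #|porbit s a|) s a.
    by rewrite -{1}(subnK le) iterD iter_porbit.
  by move: nk; rewrite e kmin //; lia.
rewrite /arcend; case: pickP => [l /andP[nl /forallP lmin]|/(_ (Ordinal kD))]; last first.
  by rewrite nk /= => /forallPn[j]; rewrite kmin.
case: (ltngtP l k) => [lk|kl|-> //]; first by rewrite kmin in nl.
by have := lmin (Ordinal kl); rewrite (negbTE nk).
Qed.

Lemma arcend_out a : ~~ inn a -> arcend a = a.
Proof. by move=> na; rewrite (@arcendE a 0). Qed.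

Lemma arcend_step a : inn a -> has_out a -> arcend (s a) = arcend a.
Proof.
move=> ia /has_outP[[|k] nk kmin]; first by rewrite /= ia in nk.
rewrite (@arcendE a k.+1) // (@arcendE (s a) k) -?iterSr // => j jk.
by rewrite -iterSr kmin.
Qed.

Lemma arcendP a : has_out a -> ~~ inn (arcend a) /\ arcend a \in porbit s a.
Proof.
by case/has_outP=> k nk kmin; rewrite (arcendE nk kmin) nk -permX mem_porbit.
Qed.

Lemma arc_last (P : pred D) a :
  (forall x, inn x -> inn (s x) -> P x -> P (s x)) -> inn a -> P a -> has_out a ->
  exists p, [/\ inn p, P p & s p = arcend a].
Proof.
move=> Ps ia Pa /has_outP[[|k] nk kmin]; first by rewrite /= ia in nk.
exists (iter k s a); rewrite (arcendE nk kmin) kmin //; split=> //.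
elim: k {nk} kmin => // k IH kmin; rewrite iterS Ps ?IH ?kmin //.
  by rewrite -iterS kmin.
by move=> j jk; rewrite kmin // ltnW.
Qed.

Lemma arc_first (P : pred D) a :
  (forall x, inn x -> inn (s x) -> P (s x) -> P x) -> inn a -> P a -> has_out a ->
  exists t, [/\ ~~ inn t, inn (s t), P (s t), arcend (s t) = arcend a & s t \in porbit s a].
Proof.
move=> Ps ia Pa ho; have /existsP[b /andP[ba nb]] := ho.
have : a \in porbit s b by rewrite porbit_sym.
case/porbitP=> k; elim: k a ia Pa ho ba => [|k IH] a ia Pa ho ba ab.
  by move: nb; rewrite -[b]perm1 -(expg0 s) -ab ia.
have [a' aE] : exists a', a = s a' by exists ((s^-1)%g a); rewrite permKV.
move: ia Pa ho ba ab; rewrite {}aE has_out_step porbit_stepE expgSr permM => ia Pa ho ba.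
move=> /perm_inj ab; case: (boolP (inn a')) => ia'; last first.
  by exists a'; rewrite ia' ia Pa mem_porbit_step porbit_id.
have [t [nt it Pt ta tp]] := IH a' ia' (Ps _ ia' ia Pa) ho ba ab.
by exists t; rewrite nt it Pt ta tp arcend_step.
Qed.

End Arcs.

(** * An Euler characteristic bound for the inner region *)

Section Region.
Variable C : sphere.
Local Notation D := (dart C).
Local Notation v := (vnext C).
Local Notation fn := (fnext C).
Local Notation op := (opp C).

Variables (pos inn : pred D) (o : D) (eps : bool) (h : D -> rat).
Hypothesis pos_opp : forall a, pos (op a) = ~~ pos a.
Hypothesis inn_fn : forall a, inn (fn a) = inn a.
Hypothesis out_o : ~~ inn o.
Hypothesis h_v : forall a, h (v a) = h a.
Hypothesis h_op : forall a, pos a = eps -> h (op a) < h a.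

Definition inner_porbits (s : {perm D}) := [set X in porbits s | [forall a in X, inn a]].
Definition inner_edges := [set a | pos a && (inn a && inn (op a))].
(** A maximal run of inner corners is represented by the outer corner [t] preceding it; [v t] and
    [arcend v inn (v t)] are the two edges bounding the run. *)
Definition arcs := [set t | ~~ inn t && inn (v t)].
Definition mono_arcs e :=
  [set t in arcs | (pos (v t) == e) && (pos (arcend v inn (v t)) == e)].

Lemma inner_porbitsP (s : {perm D}) X a : X \in inner_porbits s -> a \in X -> inn a.
Proof. by rewrite inE => /andP[_ /forallP/(_ a)/implyP]. Qed.

Lemma inner_porbits_sub (s : {perm D}) : inner_porbits s \subset porbits s.
Proof. by apply/subsetP=> X; rewrite inE => /andP[]. Qed.

Lemma inner_face a : (porbit fn a \in inner_porbits fn) = inn a.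
Proof.
rewrite inE mem_porbits /=; apply/forallP/idP => [/(_ a)|ia b].
  by rewrite porbit_id.
by apply/implyP; apply: porbit_iter_ind => // x; rewrite inn_fn.
Qed.

Lemma inn_opV a : inn (op (v a)) = inn a.
Proof. by have [b -> ->] := vnextE a; rewrite oppK inn_fn. Qed.

(* The unknowns are functions on the inner faces and the equations say that they agree across
   inner edges; the sums of these equations around inner vertices are independent relations. A
   solution vanishing at all arcs in [mono_arcs eps] is zero, as one sees at a highest point of
   the boundary of its support. *)
Lemma region_bound :
  (#|inner_porbits v| + #|inner_porbits fn| <= #|inner_edges| + #|mono_arcs eps|)%N.
Proof.
rewrite leqNgt; apply/negP=> Hlt.
pose X := inner_porbits v; pose J := inner_edges; pose I := inner_porbits fn.
pose z (x : {set D}) (j : D) : rat := (j \in x)%:R - (op j \in x)%:R.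
pose n (j : D) (i : {set D}) : rat := (j \in i)%:R - (op j \in i)%:R.
pose s (t : D) (i : {set D}) : rat := (v t \in i)%:R.
have [||//|u [uJ uS [i iI ui]]] := @kernel_exists rat _ _ _ _ X J I (mono_arcs eps) z n s.
- move=> x i xX iI; rewrite /J /inner_edges.
  rewrite (@sum_half_prod C pos pos_opp (fun a => inn a && inn (op a)) _ 
    (fun a => (a \in x)%:R) (fun a => (a \in i)%:R)); last by move=> a; rewrite oppK andbC.
  have xv := subsetP (inner_porbits_sub v) x xX.
  have fi := subsetP (inner_porbits_sub fn) i iI.
  (* The sum around an inner vertex telescopes, because [a] and [op (v a)] lie on the same face. *)
  rewrite -[RHS](sum_porbits_shift (fun a => (op a \in i)%:R : rat) xv).
  rewrite big_mkcond [RHS]big_mkcond; apply: eq_bigr => a _.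
  have -> : (op (v a) \in i) = (a \in i).
    by have [b -> ->] := vnextE a; rewrite oppK porbits_stepE.
  case: (boolP (a \in x)) => ax; last by case: ifP; rewrite ?mul0r.
  have [b av vb] : exists2 b, a = v b & b \in x.
    by exists ((v^-1)%g a); rewrite ?permKV // -(porbits_stepE _ xv) permKV.
  have ia := inner_porbitsP xX ax; have := inner_porbitsP xX vb.
  by rewrite -inn_opV -av ia => -> /=; rewrite mul1r.
- move=> psi Hpsi; have sX := inner_porbits_sub v.
  pose P a := if porbit v a \in X then psi (porbit v a) else 0.
  have Pv a : P (v a) = P a by rewrite /P porbit_stepE.
  have Pin a : P a != 0 -> inn a && inn (op a).
    rewrite /P; case: ifP => [aX _|]; last by rewrite eqxx.
    rewrite (inner_porbitsP aX) ?porbit_id //=.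
    have [b ab] : exists b, a = v b by exists ((v^-1)%g a); rewrite permKV.
    rewrite ab inn_opV; apply: (inner_porbitsP aX).
    by rewrite ab -mem_porbit_step porbit_id.
  have Ppos a : pos a -> inn a -> inn (op a) -> P (op a) = P a.
    move=> pa ia ioa; have := Hpsi a; rewrite inE pa ia ioa => /(_ isT).
    under eq_bigr do rewrite mulrBr.
    by rewrite sumrB !(@sum_indicator _ v) // -/(P _) -/(P _) => /subr0_eq.
  have Po a : P a != 0 -> P (op a) = P a.
    move=> /Pin /andP[ia ioa]; case: (boolP (pos a)) => [pa|na]; first exact: Ppos.
    by have := Ppos (op a); rewrite pos_opp oppK => /(_ na ioa ia) ->.
  (* A nonzero value of [psi] at an inner vertex would spread along edges over the whole sphere and
     make even [o] inner. *)
  move=> x xX; apply: contraNeq out_o => px.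
  have /imsetP[a _ xa] := subsetP sX x xX.
  have : P o != 0.
    apply: (@sphere_all C (fun a => P a != 0) _ _ a) => [b Pb|b Pb|].
    - by rewrite Po.
    - by rewrite -Pv vnext_fnext Po.
    by rewrite /P -xa xX.
  by case/Pin/andP.
pose U a := if porbit fn a \in I then u (porbit fn a) else 0.
have sI := inner_porbits_sub fn.
have Ufn a : U (fn a) = U a by rewrite /U porbit_stepE.
have Uin a : U a != 0 -> inn a.
  by rewrite /U; case: ifP => [|_ /eqP//]; rewrite inner_face.
have Usum a : \sum_(x in I) (a \in x)%:R * u x = U a.
  by under eq_bigr do rewrite mulrC; rewrite (@sum_indicator _ fn).
have Uop a : inn a -> inn (op a) -> U (op a) = U a.
  have Upos b : pos b -> inn b -> inn (op b) -> U (op b) = U b.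
    move=> pb ib iob; have := uJ b; rewrite inE pb ib iob => /(_ isT).
    under eq_bigr do rewrite mulrBl.
    by rewrite sumrB !Usum => /subr0_eq.
  case: (boolP (pos a)) => [pa|na] ia ioa; first exact: Upos.
  by have := Upos (op a); rewrite pos_opp oppK => /(_ na ioa ia) ->.
have Uv a : inn a -> inn (v a) -> U (v a) = U a.
  have [b -> ->] := vnextE a; rewrite inn_fn Ufn => ib iob; exact: Uop.
have UT t : t \in mono_arcs eps -> U (v t) = 0 by move/uS; rewrite Usum.
(* Boundary edges of the support of [U], with the support on their left; connectedness and the outer
   dart [o] provide one. The chosen [b] has the highest possible upper end. *)
pose Bd b := (U b != 0) && ~~ inn (op b).
have [b0 Bb0] : exists b, Bd b.
  apply/existsP; apply: contraNT out_o => /existsPn H.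
  have Hin a : U a != 0 -> inn (op a).
    by move=> Ua; have := H a; rewrite /Bd Ua /= negbK.
  have /imsetP[a _ xa] := subsetP sI i iI.
  apply: (Uin); apply: (@sphere_all C (fun a => U a != 0) _ _ a) => [b Ub|b Ub|].
  - by rewrite Uop ?Hin ?Uin.
  - by rewrite Ufn.
  by rewrite /U -xa iI.
pose g b := Num.max (h b) (h (op b)).
case: (@arg_maxP _ _ _ b0 Bd g Bb0) => b /andP[Ub nb] bmax.
have fnop a : inn (fn (op a)) = inn (op a) by rewrite inn_fn.
(* At a highest boundary point both edges bounding the run after [t] are boundary edges of the
   support, so both go down and have sign [eps]. Then [t] is in [mono_arcs eps], where the solution
   was required to vanish. *)
have key t : Bd (v t) -> h (v t) = g b -> False.
  move=> Bt ht; have /andP[Ut nt] := Bt.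
  have nit : ~~ inn t by have [c tE vc] := vnextE t; move: nt; rewrite vc oppK tE inn_fn.
  have it := Uin _ Ut.
  have ho : has_out v inn (v t) by rewrite has_out_step out_has_out.
  have [p [ip Up pE]] := @arc_last _ v inn (fun a => U a != 0) (v t)
    (fun x ix isx Px => eq_ind_r (fun y => y != 0) Px (Uv x ix isx)) it Ut ho.
  have [ne eo] := arcendP ho.
  set e := arcend v inn (v t) in pE ne eo.
  have Be : Bd (op e).
    rewrite /Bd oppK ne andbT -pE; have [c pc ->] := vnextE p.
    by rewrite oppK -Ufn -pc.
  have he : h e = g b.
    rewrite -ht; apply/eqP.
    by apply: (porbit_iter_ind (s := v) (P := fun x => h x == h (v t)) _ _ eo)
      => [x|]; rewrite ?h_v.
  have small a : h a = g b -> g b >= h (op a) -> pos a = eps.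
    move=> ha hoa; apply/eqP; apply: contraTT isT => /eqP ne'.
    have /h_op : pos (op a) = eps by rewrite pos_opp; case: (pos a) eps ne' => -[].
    by rewrite oppK ha ltNge hoa.
  have Te : t \in mono_arcs eps.
    rewrite !inE nit it /= !small ?eqxx //.
    - by apply: le_trans (bmax _ Be); rewrite /g le_max lexx.
    by apply: le_trans (bmax _ Bt); rewrite /g le_max lexx orbT.
  by rewrite UT // eqxx in Ut.
have [hb|hb] := leP (h (op b)) (h b).
  have [t tb] : exists t, b = v t by exists ((v^-1)%g b); rewrite permKV.
  by apply: (key t); rewrite -tb /Bd ?Ub ?nb // /g max_l.
(* Here [b] goes up, and [op b] closes the run of inner corners at its end; following the run back
   to its first edge reduces to [key]. *)
have ho : has_out v inn (fn b) by rewrite -has_out_step vnext_fnext out_has_out.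
have [t [nt it Ut ta tp]] := @arc_first _ v inn (fun a => U a != 0) (fn b)
    (fun x ix isx Px => eq_ind (U (v x)) (fun y => y != 0) Px _ (Uv x ix isx)) 
    (eq_ind_r is_true (Uin _ Ub) (inn_fn b)) (eq_ind_r (fun y => y != 0) Ub (Ufn b)) ho.
apply: (key t); first by rewrite /Bd Ut inn_opV.
rewrite /g max_r ?(ltW hb) //; apply/eqP.
rewrite -vnext_fnext (h_v (fn b)).
by apply: (porbit_iter_ind (s := v) (P := fun x => h x == h (fn b)) _ _ tp) => [x|]; rewrite ?h_v.
Qed.
End Region.

(** * Counting colour changes *)

Section Count.
Variable C : sphere.
Local Notation D := (dart C).
Local Notation v := (vnext C).
Local Notation fn := (fnext C).
Local Notation op := (opp C).

Lemma card_faces (n : nat) (inn : pred D) :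
  (forall a, inn (fn a) = inn a) -> (forall a, #|porbit fn a| = n) ->
  #|[set a | inn a]| = (n * #|inner_porbits inn fn|)%N.
Proof.
move=> inn_fn fn4; rewrite -sum1dep_card.
rewrite (partition_big (porbit fn) (mem (inner_porbits inn fn))) /=; last first.
  by move=> a; rewrite inner_face.
rewrite mulnC -sum_nat_const; apply: eq_bigr => X XI.
have /imsetP[a _ aX] := subsetP (inner_porbits_sub _ _) X XI.
have cX : #|X| = n by rewrite aX fn4.
rewrite -[RHS]cX sum1dep_card; apply: eq_card => b; rewrite !inE.
apply/andP/idP => [[_ /eqP<-]|bX]; first exact: porbit_id.
by rewrite (inner_porbitsP XI bX) {1}aX eq_porbit_mem -aX.
Qed.

Variables (pos inn col : pred D) (o : D) (h : D -> rat).
Hypothesis pos_opp : forall a, pos (op a) = ~~ pos a.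
Hypothesis inn_fn : forall a, inn (fn a) = inn a.
Hypothesis out_o : ~~ inn o.
Hypothesis h_v : forall a, h (v a) = h a.
Hypothesis h_op : forall a, pos a -> h a < h (op a).
Hypothesis fn4 : forall a, #|porbit fn a| = 4%N.
Hypothesis inn_col : forall a, inn a -> col (v a) (+) pos (v a) = col a (+) pos a.
Hypothesis out_mixed :
  (2 * #|[set a | ~~ inn a && (col a != col (v a))]|)%N = #|[set a | ~~ inn a]|.
Hypothesis not_mono : forall a e, ~~ inn a ->
  ~ (forall b, b \in porbit v a -> ~~ inn b -> col b = e /\ col (v b) = e).

Local Notation arcend := (arcend v inn).
(** The weight [wt a] counts the colour change at an outer corner and the one across the inner run
    right after it, the run being a single step. *)
Let switch t := inn (v t) && (col (v t) != col (arcend (v t))).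
Let wt a := ((col a != col (v a)) + switch a)%N.

(** Modulo 2 the weights telescope around the vertex, so their sum is even. If it were 0, all outer
    corners there would have one and the same colour, against [not_mono]. *)
Lemma vertex_switches a : ~~ inn a ->
  (2 <= \sum_(b | ~~ inn b && (porbit v b == porbit v a)) wt b)%N.
Proof.
move=> na; pose k b := col (arcend b).
have ho b : b \in porbit v a -> has_out v inn b.
  by move=> ba; apply/existsP; exists a; rewrite porbit_sym ba.
have kv b : b \in porbit v a -> inn b -> k (v b) = k b.
  by move=> ba ib; rewrite /k arcend_step ?ho.
set S := (\sum_(b | _) _)%N.
have : ~~ odd S.
  rewrite /S (big_morph _ oddD (erefl _)).
  have -> : \big[addb/false]_(b | ~~ inn b && (porbit v b == porbit v a)) odd (wt b) =
            \big[addb/false]_(b in porbit v a) (k b (+) k (v b)).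
    rewrite big_mkcond [RHS]big_mkcond; apply: eq_bigr => b _.
    rewrite eq_porbit_mem; case: (boolP (b \in porbit v a)) => ba; last by rewrite andbF.
    rewrite andbT; case: (boolP (inn b)) => ib /=; first by rewrite kv ?addbb.
    have -> : k b = col b by rewrite /k arcend_out.
    rewrite /wt /switch oddD !oddb -/(k (v b)); case: (boolP (inn (v b))) => ivb /=.
      by case: (col b); case: (col (v b)); case: (k (v b)).
    by rewrite /k (arcend_out _ ivb) addbF; case: (col b); case: (col (v b)).
  rewrite big_split /= [X in X (+) _](_ : _ = \big[addb/false]_(b in porbit v a) k (v b)).
    by rewrite addbb.
  rewrite (reindex_inj (@perm_inj _ v)) /=.
  by apply: eq_bigl => b; rewrite mem_porbit_step.
case S0: S => [|[|]] //= _; exfalso.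
have wt0 b : b \in porbit v a -> ~~ inn b -> wt b = 0%N.
  move=> ba nb; move/eqP: S0; rewrite /S sum_nat_eq0 => /forallP/(_ b).
  by rewrite nb eq_porbit_mem ba => /eqP.
have kc b : b \in porbit v a -> k b = k a.
  move=> ba; apply/eqP.
  have : (k b == k a) && (b \in porbit v a).
    apply: (porbit_iter_ind (s := v)
      (P := fun b => (k b == k a) && (b \in porbit v a)) _ _ ba); last first.
      by rewrite eqxx porbit_id.
    move=> x /andP[/eqP <- xa]; rewrite mem_porbit_step xa andbT.
    case: (boolP (inn x)) => ix; first by rewrite kv.
    have := wt0 x xa ix; rewrite /wt /switch {2}/k (arcend_out _ ix).
    case: (boolP (inn (v x))) => ivx /=.
      by rewrite /k; case: (col x); case: (col (v x)); case: (col (arcend _)).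
    by rewrite /k arcend_out //; case: (col x); case: (col (v x)).
  by case/andP.
apply: (not_mono (a := a) (e := k a) na) => b ba nb.
have := wt0 b ba nb; rewrite -(kc b ba) /k (arcend_out _ nb) /wt.
by case: (col b); case: (col (v b)).
Qed.

(** Along a run of inner corners [col] and [pos] differ by a constant. *)
Lemma switch_arc t : t \in arcs inn ->
  (col (v t) != col (arcend (v t))) = (pos (v t) != pos (arcend (v t))).
Proof.
rewrite inE => /andP[nt it].
have ho : has_out v inn (v t) by rewrite has_out_step out_has_out.
have [p [ip /eqP pq <-]] := arc_last (P := fun x => col x (+) pos x == col (v t) (+) pos (v t))
   (fun x ix _ Px => eq_ind_r (fun y => y == _) Px (inn_col ix)) it (eqxx _) ho.
move: pq; rewrite -inn_col //.
by case: (col (v p)); case: (pos (v p)); case: (col (v t)); case: (pos (v t)).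
Qed.

(** Adding [region_bound] for both signs to the count of at least two colour changes at each vertex
    with an outer corner, where half of the outer corners and the non-monochromatic arcs contribute,
    yields at most as many vertices as faces. In a sphere made of quadrilaterals there are two
    vertices more than faces. *)
Lemma outer_contradiction : False.
Proof.
have E := sphere_euler C; rewrite -[vnext_of _ _]/v in E.
have cE := card_edges pos_opp.
have cD := @card_half C pos pos_opp xpredT (fun=> erefl).
have cP : #|[set a | pos a && true]| = #|[set a | pos a]|.
  by apply: eq_card => a; rewrite !inE andbT.
have cF := @card_faces 4 xpredT (fun=> erefl) fn4.
have cF' : #|inner_porbits xpredT fn| = #|porbits fn|.
  apply: eq_card => X; rewrite inE; case: (_ \in _) => //=.
  by apply/forallP=> a; apply/implyP.
have cFi := card_faces inn_fn fn4.
have cI : (#|[set a | inn a]| + #|[set a | ~~ inn a]| = #|[set a : D | xpredT a]|)%N.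
  by rewrite -(cardsID [set a | inn a] setT); congr (_ + _)%N; apply: eq_card => a; rewrite !inE ?andbT.
have cA : #|arcs inn| = #|[set a | inn a && ~~ inn (op a)]|.
  rewrite -(card_imset _ (@perm_inj _ v)); apply: eq_card => a.
  have [b ->] : exists b, a = v b by exists ((v^-1)%g a); rewrite permKV.
  by rewrite (mem_imset _ _ (@perm_inj _ v)) !inE inn_opV // andbC.
have cI2 : (#|[set a | inn a]| = 2 * #|inner_edges pos inn| + #|arcs inn|)%N.
  rewrite cA mul2n -(@card_half C pos pos_opp (fun a => inn a && inn (op a))); last first.
    by move=> a; rewrite oppK andbC.
  rewrite -(cardsID [set a | inn (op a)]); congr (_ + _)%N; apply: eq_card => a;
    rewrite !inE //; exact: andbC.
(* Highest points give the bound for sign [false]; negating the height gives it for [true]. *)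
have b1 := @region_bound C pos inn o false h pos_opp inn_fn out_o h_v.
have b2 := @region_bound C pos inn o true (fun a => - h a) pos_opp inn_fn out_o.
have {}b1 : (#|inner_porbits inn v| + #|inner_porbits inn fn|
             <= #|inner_edges pos inn| + #|mono_arcs pos inn false|)%N.
  by apply: b1 => a pa; have := @h_op (op a); rewrite oppK pos_opp pa; apply.
have {}b2 : (#|inner_porbits inn v| + #|inner_porbits inn fn|
             <= #|inner_edges pos inn| + #|mono_arcs pos inn true|)%N.
  by apply: b2 => a; [rewrite h_v | move=> pa; rewrite ltrN2 h_op].
pose J := [set t in arcs inn | switch t].
have cJ : (#|arcs inn| = #|J| + #|mono_arcs pos inn true| + #|mono_arcs pos inn false|)%N.
  rewrite -!sum1_card [RHS]addnAC.
  rewrite !(big_mkcond (fun i => i \in _)) /= -!big_split /=; apply: eq_bigr => t _.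
  rewrite [t \in J]inE [t \in mono_arcs _ _ _]inE [t \in mono_arcs _ _ _]inE /switch.
  case: (boolP (t \in arcs inn)) => tA //=.
  rewrite switch_arc //; move: tA; rewrite inE => /andP[_ ->] /=.
  by case: (pos (v t)); case: (pos (arcend (v t))).
have cV : (#|porbits v| = #|inner_porbits inn v| + #|porbits v :\: inner_porbits inn v|)%N.
  rewrite -(cardsID (inner_porbits inn v)); congr (_ + _)%N.
  by apply: eq_card => X; rewrite !inE; case: (_ \in _).
have W : (2 * #|porbits v :\: inner_porbits inn v| <= \sum_(a | ~~ inn a) wt a)%N.
  rewrite mulnC -sum_nat_const (partition_big (porbit v) (mem (porbits v :\: inner_porbits inn v))) /=.
    apply: leq_sum => X; rewrite !inE => /andP[+ Xv]; rewrite Xv /= => /forallPn[a].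
    rewrite negb_imply => /andP[aX na].
    have -> : X = porbit v a by apply/eqP; rewrite -porbits_mem.
    exact: vertex_switches.
  move=> a na; rewrite !inE mem_porbits andbT /=.
  by apply/forallPn; exists a; rewrite porbit_id.
have cW : (\sum_(a | ~~ inn a) wt a = #|[set a | ~~ inn a && (col a != col (v a))]| + #|J|)%N.
  rewrite big_split /= -!sum1_card; congr (_ + _)%N.
    by rewrite -big_mkcondr; apply: eq_bigl => a; rewrite inE.
  have -> : (\sum_(a | ~~ inn a) switch a = \sum_(a | ~~ inn a && switch a) 1)%N.
    by rewrite big_mkcondr; apply: eq_bigr => a _; case: (switch a).
  by apply: eq_bigl => a; rewrite !inE /switch; case: (inn (v a)); rewrite ?andbF ?andbT.
have nD : #|[set a : D | xpredT a]| = (2 * #|[set a | pos a]|)%N by rewrite -cP mul2n -cD.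
have nF : #|[set a : D | xpredT a]| = (4 * #|porbits fn|)%N by rewrite -cF' -cF.
move: E cE nD nF cFi cI cI2 b1 b2 cJ cV W cW out_mixed; clear.
move: #|porbits v| #|porbits fn| #|porbits op| #|[set a | pos a]| #|[set a : D | xpredT a]|.
move: #|J| #|[set a | inn a]| #|[set a | ~~ inn a]| #|inner_edges pos inn| #|arcs inn|.
move: #|inner_porbits inn v| #|inner_porbits inn fn| #|mono_arcs pos inn true|.
move: #|mono_arcs pos inn false| #|porbits v :\: inner_porbits inn v|.
move: (\sum_(a | ~~ inn a) wt a)%N #|[set a | ~~ inn a && (col a != col (v a))]|.
by lia.
Qed.

End Count.

(** * Trees *)

Section Forest.
Variables (V E : finType) (g : ograph V E).

Definition edges_in (S : {set V}) := [set e | (src g e \in S) && (tgt g e \in S)].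

Definition adjacent_avoiding (e : E) : rel V :=
  fun x y => [exists a : E * bool, [&& a.1 != e, esrc g a == x & etgt g a == y]].

Lemma adjacent_avoiding_sym e : symmetric (adjacent_avoiding e).
Proof.
suff H x y : adjacent_avoiding e x y -> adjacent_avoiding e y x.
  by move=> x y; apply/idP/idP; apply: H.
case/existsP=> a /and3P[ae ax ay]; apply/existsP; exists (ebar a).
by rewrite /= ae -/(etgt g a) ay /etgt ebarK.
Qed.

(** A repeated edge would repeat a vertex. The arbitrary [a] and [b] at the ends let [edge_bridge]
    close the path up with [e]. *)
Lemma lift_path e x p : path (adjacent_avoiding e) x p -> uniq (x :: p) ->
  exists q : seq (E * bool),
    [/\ forall a b, etgt g a = x -> esrc g b = last x p -> path (follows g) a (rcons q b),
        map (esrc g) q = belast x p, uniq (map fst q), e \notin map fst q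
      & forall a, a \in q -> (esrc g a \in x :: p) && (etgt g a \in x :: p)].
Proof.
elim: p x => [|y p IH] x /=.
  by move=> _ _; exists [::]; split=> // a b ax bx; rewrite /= /follows ax bx eqxx.
case/andP=> /existsP[a /and3P[ae /eqP ax /eqP ay]] /IH{}IH /andP[xyp uyp].
have [q [q1 q2 q3 q4 q5]] := IH uyp.
exists (a :: q); split=> /=.
- by move=> b c bx cl; rewrite q1 // andbT /follows bx ax.
- by rewrite ax q2.
- rewrite q3 andbT; apply/mapP=> -[b bq ab].
  have /andP[b1 b2] := q5 b bq; move: xyp.
  have : (x == esrc g b) || (x == etgt g b).
    by rewrite -ax /etgt /esrc /= -ab; case: (a.2); case: (b.2); rewrite eqxx ?orbT.
  by case/orP=> /eqP ->; rewrite ?b1 ?b2.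
- by rewrite inE negb_or eq_sym ae.
move=> b; rewrite inE => /orP[/eqP->|/q5/andP[b1 b2]].
  by rewrite ax ay !inE !eqxx orbT.
by rewrite !(in_cons x) b1 b2 !orbT.
Qed.

Hypothesis acyclic : forall p : seq (E * bool), ~~ circuit g p.

Lemma edge_bridge e : ~~ connect (adjacent_avoiding e) (tgt g e) (src g e).
Proof.
apply/negP=> /connectP[p0 p0e]; case/shortenP: p0e => p pe pu _ le.
have [q [q1 q2 q3 q4 q5]] := lift_path pe pu.
case/negP: (acyclic ((e, true) :: q)); rewrite /circuit /= q1 //= q4 q3 andbT /=.
by move: pu; rewrite andbT lastI rcons_uniq -q2 -le; rewrite /esrc /=.
Qed.

(** With at least as many edges as vertices the incidence equations would have a nonzero solution,
    that is, a cycle in homology; but a bridge has coefficient 0 in every cycle. *)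
Lemma forest_card (S : {set V}) : S != set0 -> (#|edges_in S| < #|S|)%N.
Proof.
move=> S0; rewrite ltnNge; apply/negP=> le.
pose n (x : V) (e : E) : rat := (src g e == x)%:R - (tgt g e == x)%:R.
have sum1 (f : V -> rat) x : x \in S -> \sum_(y in S) f y * (x == y)%:R = f x.
  move=> xS; rewrite (bigD1 x) //= eqxx mulr1 big1 ?addr0 // => y /andP[_].
  by rewrite eq_sym => /negbTE->; rewrite mulr0.
have sumn (f : V -> rat) e : e \in edges_in S ->
    \sum_(x in S) f x * n x e = f (src g e) - f (tgt g e).
  rewrite inE => /andP[e1 e2]; under eq_bigr do rewrite mulrBr.
  by rewrite sumrB !sum1.
have [|||u [uJ _ [e eI ue]]] := @kernel_exists rat unit _ _ unit [set tt] S (edges_in S) set0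
   (fun _ _ => 1) n (fun _ _ => 0).
- by move=> x e _ eI; rewrite (sumn (fun=> 1)) // subrr.
- move=> psi H [] _; have /set0Pn[x xS] := S0.
  by have := H x xS; rewrite big_set1 mulr1.
- by rewrite cards1 cards0 addn0.
(* The indicator of one side of the bridge [e] has nonzero difference on [e] only, so pairing it
   with the cycle isolates [u e]. *)
pose f x : rat := (connect (adjacent_avoiding e) (tgt g e) x)%:R.
have : \sum_(x in S) f x * (\sum_(i in edges_in S) n x i * u i) = 0.
  by apply: big1 => x /uJ ->; rewrite mulr0.
under eq_bigr do rewrite mulr_sumr; rewrite exchange_big /=.
rewrite (bigD1 e) //= [X in _ + X]big1 ?addr0 => [|i /andP[iI ie]].
  under eq_bigr do rewrite mulrA; rewrite -mulr_suml sumn // /f connect0.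
  rewrite (negbTE (edge_bridge e)) sub0r mulN1r => /eqP.
  by rewrite oppr_eq0 (negbTE ue).
under eq_bigr do rewrite mulrA; rewrite -mulr_suml sumn // /f.
suff -> : connect (adjacent_avoiding e) (tgt g e) (src g i) =
          connect (adjacent_avoiding e) (tgt g e) (tgt g i) by rewrite subrr mul0r.
apply: same_connect_r; first by apply: sym_connect_sym; exact: adjacent_avoiding_sym.
apply: connect1; apply/existsP; exists (i, true).
by rewrite /= ie /etgt /esrc /= !eqxx.
Qed.

(** With fewer edges there would be a nonzero function that is constant along edges and vanishes at
    [x0]. *)
Lemma connected_card : (0 < #|V|)%N -> (forall x y, connect (adjacent g) x y) ->
  (#|V| <= #|E|.+1)%N.
Proof.
move=> /card_gt0P[x0 _] conn; rewrite leqNgt; apply/negP=> lt.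
have [|||u [uJ uS [x _ ux]]] := @kernel_exists rat unit E V unit set0 setT setT [set tt]
   (fun _ _ => 0) (fun e x => (x == src g e)%:R - (x == tgt g e)%:R) (fun _ x => (x == x0)%:R).
- by move=> ?; rewrite inE.
- by move=> ? _ ?; rewrite inE.
- by rewrite cards1 cards0 !cardsT addn1.
have sum1 y : \sum_(x in [set: V]) (x == y)%:R * u x = u y.
  rewrite (bigD1 y) ?inE //= eqxx mul1r big1 ?addr0 // => z /andP[_ /negbTE->].
  by rewrite mul0r.
have ue e : u (src g e) = u (tgt g e).
  have := uJ e; rewrite inE => /(_ isT); under eq_bigr do rewrite mulrBl.
  by rewrite sumrB !sum1 => /subr0_eq.
have ua y z : adjacent g y z -> u y = u z.
  case/existsP=> -[e []] /andP[/eqP<- /eqP<-]; rewrite /etgt /esrc //=.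
have /connectP[p] := conn x0 x.
have : u x0 = 0 by have := uS tt; rewrite sum1 inE; apply.
elim: p x0 {uS conn} => [|y p IH] x0 /= u0; first by move=> _ xx; rewrite xx u0 eqxx in ux.
by case/andP=> /ua e; apply: IH; rewrite -e.
Qed.

End Forest.

Lemma tree_card (V E : finType) (g : ograph V E) : is_tree g -> #|V| = #|E|.+1.
Proof.
case=> V0 conn acy; apply/eqP; rewrite eqn_leq (connected_card V0 conn) /=.
have -> : #|E| = #|edges_in g setT| by rewrite -cardsT; apply: eq_card => e; rewrite !inE.
by rewrite -cardsT forest_card // -card_gt0 cardsT.
Qed.

(** * Two disjoint arborescences *)

Section Arborescences.
Variables (W E : finType) (Q : {set W}) (O : {set E}) (r : W).
Variables (lab : E -> W) (hd : bool -> E -> W).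
Hypothesis rQ : r \in Q.
Hypothesis lab_inj : {in O &, injective lab}.
Hypothesis lab_Q : forall e, e \in O -> lab e \in Q :\ r.
Hypothesis hd_Q : forall e b, e \in O -> hd b e \in Q.
Hypothesis cut2 : forall S : {set W}, S != set0 -> S \subset Q :\ r ->
  (1 < #|[set x : E * bool | [&& x.1 \in O, lab x.1 \in S & hd x.2 x.1 \notin S]]|)%N.

Definition cut (A : {set W}) (c : W -> bool) (S : {set W}) :=
  [set x : E * bool | [&& x.1 \in O, lab x.1 \in S, hd x.2 x.1 \notin S &
     (lab x.1 \notin A) || (x.2 != c (lab x.1))]].

Lemma cut_submodular A c (S1 S2 : {set W}) :
  (#|cut A c (S1 :&: S2)| + #|cut A c (S1 :|: S2)| <= #|cut A c S1| + #|cut A c S2|)%N.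
Proof.
rewrite -!sum1_card !(big_mkcond (fun x => x \in _)) /= -!big_split /=.
apply: leq_sum => x _; rewrite !inE.
case: (_ \in O); case: (_ || _); rewrite ?andbF //= !andbT.
by do 4!case: (_ \in _).
Qed.

(* Lovasz's argument: the arc is chosen inside a smallest tight set, and submodularity of
   the cut then prevents it from being the last arc out of any other set. *)
Lemma arborescence_step (A : {set W}) c :
  r \in A -> A \proper Q ->
  (forall S : {set W}, S != set0 -> S \subset Q :\ r -> (0 < #|cut A c S|)%N) ->
  exists x : E * bool, [/\ x.1 \in O, lab x.1 \notin A, hd x.2 x.1 \in A &
    forall S : {set W}, S \subset Q :\ r -> x \in cut A c S -> (1 < #|cut A c S|)%N].
Proof.
move=> rA /properP[AQ [w wQ wA]] inv.
pose tight (S : {set W}) := [&& S \subset Q :\ r, S :\: A != set0 & #|cut A c S| == 1%N].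
have notA (S : {set W}) x : S \subset Q :\ r -> x \in cut A c S -> lab x.1 \notin A ->
    ~~ tight S -> (1 < #|cut A c S|)%N.
  move=> sS xS xA; have := xS; rewrite inE => /and4P[xO labS _ _].
  rewrite /tight sS; have -> /= : S :\: A != set0 by apply/set0Pn; exists (lab x.1); rewrite inE xA.
  have : (0 < #|cut A c S|)%N by apply/card_gt0P; exists x.
  by case: #|_| => [|[|]].
have sQA : Q :\: A \subset Q :\ r by apply: setDS; rewrite sub1set.
case: (pickP tight) => [S0 tS0|ntight]; last first.
  have QA0 : Q :\: A != set0 by apply/set0Pn; exists w; rewrite inE wA.
  have /card_gt0P[x xc] := inv _ QA0 sQA.
  have := xc; rewrite inE => /and4P[xO]; rewrite !inE => /andP[xA _].
  rewrite negb_and negbK hd_Q // orbF => hA _.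
  exists x; split=> // S sS xS.
  by apply: notA xS xA _ => //; rewrite ntight.
have [S /and3P[sS SA0 /eqP cS] Smin] := arg_minnP (fun S : {set W} => #|S|) tS0.
have sD : S :\: A \subset Q :\ r by apply: subset_trans sS; apply: subsetDl.
(* Arcs from outside [A] are all free, and at least two leave [S :\: A]; only one can leave the
   tight set [S], so another ends in the part of [S] inside [A]. *)
have [x xD hS] : exists2 x, x \in cut A c (S :\: A) & hd x.2 x.1 \in S.
  apply/exists_inP; apply: contraLR (cut2 SA0 sD) => /exists_inPn H.
  rewrite -leqNgt -cS; apply: subset_leq_card; apply/subsetP=> x.
  rewrite !inE => /and3P[xO /andP[xA xS] hx].
  have := H x; rewrite !inE xO xA xS hx /= => /(_ isT) ->.
  by [].
have := xD; rewrite !inE hS andbT negbK => /and4P[xO /andP[xA xS] hA _].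
exists x; split=> // S' sS' xS'; apply: contraTT hS.
move=> ns; have tS' : tight S' by apply: contraNT ns; apply: notA sS' xS' xA.
have /and3P[_ _ /eqP cS'] := tS'.
have xSS : lab x.1 \in S :&: S' by move: xS'; rewrite !inE xS => /and4P[_ -> _ _].
have sI : S :&: S' \subset Q :\ r by apply: subset_trans sS; apply: subsetIl.
have i0 : S :&: S' != set0 by apply/set0Pn; exists (lab x.1).
have u0 : S :|: S' != set0 by apply/set0Pn; exists (lab x.1); rewrite inE xS.
have sU : S :|: S' \subset Q :\ r by rewrite subUset sS.
have := cut_submodular A c S S'; have := inv _ i0 sI; have := inv _ u0 sU.
rewrite cS cS' => c1 c2 c3.
have tI : tight (S :&: S').
  rewrite /tight sI /=; apply/andP; split; last first.
    rewrite eqn_leq c2 andbT -(leq_add2r #|cut A c (S :|: S')|).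
    by apply: leq_trans c3 _; rewrite leq_add2l.
  by apply/set0Pn; exists (lab x.1); rewrite inE xA.
have := Smin _ tI => /(conj (subsetIl S S')) [sub le].
have /eqP <- : S :&: S' == S by rewrite eqEcard sub le.
by rewrite inE negb_and; move: xS'; rewrite inE => /and4P[_ _ -> _]; rewrite orbT.
Qed.

(** An arborescence on [A] towards the root, given by its choice [c] of arcs; the decreasing depth
    [d] certifies that there is no cycle. *)
Definition descends (A : {set W}) (c : W -> bool) (d : W -> nat) :=
  forall e, e \in O -> lab e \in A ->
    hd (c (lab e)) e \in A /\ (d (hd (c (lab e)) e) < d (lab e))%N.

Lemma descends_extend (A : {set W}) c d (x : E * bool) : x.1 \in O -> lab x.1 \notin A -> hd x.2 x.1 \in A ->
  descends A c d ->
  descends (lab x.1 |: A) (fun w => if w == lab x.1 then x.2 else c w)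
    (fun w => if w == lab x.1 then (d (hd x.2 x.1)).+1 else d w).
Proof.
move=> xO xA hA H e eO; rewrite !inE; case: eqP => [/lab_inj -> // _ |ne /= eA].
  have -> : (hd x.2 x.1 == lab x.1) = false by apply: contraNF xA => /eqP <-.
  by rewrite hA orbT.
have [h1 h2] := H e eO eA; rewrite h1 orbT.
by have -> : (hd (c (lab e)) e == lab x.1) = false by apply: contraNF xA => /eqP <-.
Qed.

(** Grows [A] by the arcs of [arborescence_step], which preserve the invariant that every set
    avoiding the root keeps a free leaving arc. *)
Lemma first_arborescence n (A : {set W}) c d : r \in A -> A \subset Q -> (#|Q :\: A| <= n)%N ->
  descends A c d ->
  (forall S : {set W}, S != set0 -> S \subset Q :\ r -> (0 < #|cut A c S|)%N) ->
  exists c' d', descends Q c' d' /\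
    forall S : {set W}, S != set0 -> S \subset Q :\ r -> (0 < #|cut Q c' S|)%N.
Proof.
elim: n A c d => [|n IH] A c d rA AQ le dA inv.
  have AE : A = Q by apply/eqP; rewrite eqEsubset AQ -setD_eq0 -cards_eq0 -leqn0.
  by exists c, d; rewrite -{1}AE; split=> // S; rewrite -{2}AE; exact: inv.
have [AE|nAQ] := eqVneq Q A.
  by exists c, d; rewrite {1}AE; split=> // S; rewrite {2}AE; exact: inv.
have [|x [xO xA hA xc]] := arborescence_step rA _ inv; first by rewrite properEneq eq_sym nAQ.
apply: IH (descends_extend xO xA hA dA) _; rewrite ?inE ?rA ?orbT //.
- by have := lab_Q xO; rewrite subUset sub1set AQ inE => /andP[_ ->].
- have aQ : lab x.1 \in Q :\: A by rewrite inE xA; have := lab_Q xO; rewrite inE => /andP[].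
  move: le; rewrite (cardsD1 (lab x.1) (Q :\: A)) aQ => le.
  suff -> : Q :\: (lab x.1 |: A) = (Q :\: A) :\ lab x.1 by lia.
  by apply/setP=> w; rewrite !inE negb_or andbA.
move=> S S0 sS.
have : (0 < #|cut A c S :\ x|)%N.
  have := cardsD1 x (cut A c S); case: (boolP (x \in cut A c S)) => xS.
    by have := xc S sS xS; lia.
  by have := inv S S0 sS; lia.
case/card_gt0P=> y; rewrite !inE => /andP[yx /and4P[yO yS hy yc]].
apply/card_gt0P; exists y; rewrite !inE yO yS hy /=.
case: eqP => [/lab_inj yx1|_] //=; apply: contraNneq yx => y2.
by apply/eqP; rewrite [y]surjective_pairing [x]surjective_pairing yx1 // y2.
Qed.

(** Only one arborescence remains to be built, so a greedy choice of an arc leaving [Q :\: A]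
    suffices. *)
Lemma second_arborescence n (A : {set W}) c d : r \in A -> A \subset Q -> (#|Q :\: A| <= n)%N ->
  descends A c d ->
  (forall S : {set W}, S != set0 -> S \subset Q :\ r ->
     exists e, [/\ e \in O, lab e \in S & hd (c (lab e)) e \notin S]) ->
  exists d', descends Q c d'.
Proof.
elim: n A d => [|n IH] A d rA AQ le dA inv.
  suff <- : A = Q by exists d.
  by apply/eqP; rewrite eqEsubset AQ -setD_eq0 -cards_eq0 -leqn0.
have [->|nAQ] := eqVneq Q A; first by exists d.
have QA0 : Q :\: A != set0 by apply: contraNneq nAQ => /eqP; rewrite setD_eq0 eqEsubset AQ => ->.
have [|e [eO]] := inv _ QA0; first by apply: setDS; rewrite sub1set.
rewrite !inE => /andP[eA _]; rewrite negb_and negbK hd_Q // orbF => hA.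
have := @descends_extend A c d (e, c (lab e)) eO eA hA dA => /= dA'.
apply: (IH (lab e |: A) (fun w => if w == lab e then (d (hd (c (lab e)) e)).+1 else d w)) => //.
- by rewrite !inE rA orbT.
- by have := lab_Q eO; rewrite subUset sub1set AQ inE => /andP[_ ->].
- have aQ : lab e \in Q :\: A by rewrite inE eA; have := lab_Q eO; rewrite inE => /andP[].
  move: le; rewrite (cardsD1 (lab e) (Q :\: A)) aQ => le.
  suff -> : Q :\: (lab e |: A) = (Q :\: A) :\ lab e by lia.
  by apply/setP=> w; rewrite !inE negb_or andbA.
by move=> e' e'O e'A; have := dA' e' e'O e'A; case: eqP => // ->.
Qed.

(** Each label has just two arcs, so the second arborescence takes the one left by the first:
    arborescence [eps] uses at [w] the arc numbered [sg w (+) eps]. *)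
Lemma two_arborescences : exists (sg : W -> bool) (dep : bool -> W -> nat),
  forall e eps, e \in O -> (dep eps (hd (sg (lab e) (+) eps) e) < dep eps (lab e))%N.
Proof.
have d0 c d : descends [set r] c d.
  by move=> e eO; have := lab_Q eO; rewrite !inE => /andP[/negbTE ->].
have sr : [set r] \subset Q by rewrite sub1set.
have rr : r \in [set r] by rewrite inE.
have [S S0 sS|c [d1 [D1 H1]]] :=
    @first_arborescence _ _ (fun=> true) (fun=> 0%N) rr sr (leqnn _) (d0 _ _).
  have /ltnW/card_gt0P[x] := cut2 S0 sS; rewrite inE => /and3P[xO xS hx].
  apply/card_gt0P; exists x; rewrite !inE xO xS hx /=.
  by have := subsetP sS _ xS; rewrite !inE => /andP[->].
have [S S0 sS|d2 D2] :=
    @second_arborescence _ _ (fun w => ~~ c w) (fun=> 0%N) rr sr (leqnn _) (d0 _ _).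
  have /card_gt0P[x] := H1 S S0 sS; rewrite inE => /and4P[xO xS hx].
  have := lab_Q xO; rewrite inE => /andP[_ ->] /= xc.
  exists x.1; split=> //; suff -> : ~~ c (lab x.1) = x.2 by [].
  by case: (c _) xc; case: x.2.
exists c, (fun eps => if eps then d2 else d1) => e [] eO; rewrite ?addbT ?addbF.
  by have := lab_Q eO; rewrite inE => /andP[_ /(D2 e eO)[]].
by have := lab_Q eO; rewrite inE => /andP[_ /(D1 e eO)[]].
Qed.

End Arborescences.

(** * Partitions into sub-LOTs *)

Section Partition.
Variable G : LOG.
Local Notation V := (lvert G).
Local Notation E := (ledge G).
Local Notation g := (lgraph G).

Definition endp (b : bool) (e : E) : V := if b then src g e else tgt g e.

(** In a forest, having one edge fewer than vertices means that [P] spans a subtree. *)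
Definition subLOT (P : {set V}) :=
  [&& P != set0, [forall e in edges_in g P, label e \in P] & #|edges_in g P|.+1 == #|P|].

Lemma subLOT_label P e : subLOT P -> e \in edges_in g P -> label e \in P.
Proof. by case/and3P=> _ /forall_inP H _; apply: H. Qed.

Lemma subLOT_card P : subLOT P -> #|P| = #|edges_in g P|.+1.
Proof. by case/and3P=> _ _ /eqP. Qed.

Lemma LOT_subLOT : is_LOT G -> subLOT setT.
Proof.
move=> hT; have [V0 _ _] := hT; rewrite /subLOT -card_gt0 cardsT V0 /=.
apply/andP; split; first by apply/forall_inP=> e; rewrite inE.
by rewrite (tree_card hT) -cardsT; apply/eqP; congr _.+1; apply: eq_card => e; rewrite !inE.
Qed.

Hypothesis forest : forall S : {set V}, S != set0 -> (#|edges_in g S| < #|S|)%N.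
Hypothesis label_inj : injective (@label G).
Variable T : {set V}.
Hypothesis subT : subLOT T.

Definition subLOT_partition (Q : {set {set V}}) :=
  partition Q T && [forall B in Q, subLOT B].

Definition outer (Q : {set {set V}}) :=
  [set e in edges_in g T | pblock Q (src g e) != pblock Q (tgt g e)].

Definition label_block (Q : {set {set V}}) e := pblock Q (label e).

Section Blocks.
Variable Q : {set {set V}}.
Hypothesis QT : subLOT_partition Q.

Lemma cover_Q : cover Q = T.
Proof. by have /andP[/and3P[/eqP]] := QT. Qed.

Lemma triv_Q : trivIset Q.
Proof. by have /andP[/and3P[]] := QT. Qed.

Lemma block_subLOT B : B \in Q -> subLOT B.
Proof. by have /andP[_ /forall_inP H] := QT => /H. Qed.

Lemma pblock_Q x : x \in T -> pblock Q x \in Q.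
Proof. by rewrite -cover_Q; apply: pblock_mem. Qed.

Lemma mem_cover_sub (S : {set {set V}}) x : S \subset Q -> x \in T ->
  (x \in cover S) = (pblock Q x \in S).
Proof.
move=> /subsetP SQ xT; apply/bigcupP/idP => [[B BS xB]|pS].
  by rewrite (def_pblock triv_Q (SQ _ BS) xB).
by exists (pblock Q x); rewrite // mem_pblock cover_Q.
Qed.

Lemma cover_sub (S : {set {set V}}) : S \subset Q -> cover S \subset T.
Proof.
move=> /subsetP SQ; rewrite -cover_Q; apply/bigcupsP=> B /SQ BQ.
exact: (bigcup_sup B).
Qed.

Lemma edge_ends b e : e \in edges_in g T -> endp b e \in T.
Proof. by rewrite inE => /andP[]; case: b. Qed.

Lemma edges_in_block B e : B \in Q ->
  (e \in edges_in g B) = [&& e \in edges_in g T, pblock Q (src g e) == B & pblock Q (tgt g e) == B].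
Proof.
move=> BQ; have sB : [set B] \subset Q by rewrite sub1set.
have BT x : x \in B -> x \in T by move=> xB; rewrite -cover_Q; apply/bigcupP; exists B.
have H x : x \in T -> (x \in B) = (pblock Q x == B).
  by move=> xT; have := mem_cover_sub sB xT; rewrite inE /cover big_set1.
rewrite !inE; apply/andP/and3P => [[xs xt]|[/andP[xs xt] /eqP ps /eqP pt]].
  by rewrite -!H ?BT.
by rewrite !H // ps pt eqxx.
Qed.

Definition outer_in (S : {set {set V}}) :=
  [set e in outer Q | (pblock Q (src g e) \in S) && (pblock Q (tgt g e) \in S)].

Lemma edges_in_cover (S : {set {set V}}) e : S \subset Q ->
  (e \in edges_in g (cover S)) =
  [&& e \in edges_in g T, pblock Q (src g e) \in S & pblock Q (tgt g e) \in S].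
Proof.
move=> SQ; rewrite ![in LHS]inE; apply/andP/and3P => [[h1 h2]|].
  have [t1 t2] := (subsetP (cover_sub SQ) _ h1, subsetP (cover_sub SQ) _ h2).
  by rewrite inE t1 t2 -!mem_cover_sub.
by rewrite inE => -[/andP[t1 t2] h1 h2]; rewrite !mem_cover_sub.
Qed.

(** Each block has one edge fewer than vertices, and the remaining edges of the union join different
    blocks. *)
Lemma card_edges_cover (S : {set {set V}}) : S \subset Q ->
  (#|edges_in g (cover S)| + #|S| = #|cover S| + #|outer_in S|)%N.
Proof.
move=> SQ; have tS : trivIset S by apply: trivIsetS triv_Q.
rewrite -(cardsID (outer Q)) -addnA addnC; congr (_ + _)%N; last first.
  apply: eq_card => e; rewrite inE edges_in_cover // !inE.
  by case: (_ \in T); case: (_ \in T); case: (_ \in S); case: (_ \in S); rewrite ?andbT ?andbF.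
have /eqP <- : (\sum_(B in S) #|B|)%N == #|cover S| := tS.
rewrite -!sum1_card.
rewrite (partition_big (fun e => pblock Q (src g e)) (mem S)) /=; last first.
  by move=> e; rewrite inE edges_in_cover // => /andP[_ /and3P[]].
rewrite -big_split /=; apply: eq_bigr => B BS.
have BQ := subsetP SQ B BS.
rewrite (subLOT_card (block_subLOT BQ)) addn1; congr _.+1.
rewrite -sum1_card; apply: eq_bigl => e.
rewrite edges_in_block // inE edges_in_cover // !inE.
case: (_ \in T); case: (_ \in T); rewrite ?andbF //=.
case: (pblock Q (src g e) =P B) => [->|_]; rewrite ?andbF //= BS andbT.
by rewrite negbK eq_sym; case: eqP => [->|_]; rewrite ?BS ?andbF.
Qed.

Lemma outer_in_card (S : {set {set V}}) : S \subset Q -> S != set0 -> (#|outer_in S| < #|S|)%N.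
Proof.
move=> SQ S0; have c0 : cover S != set0.
  have /set0Pn[B BS] := S0; have /and3P[/set0Pn[x xB] _ _] := block_subLOT (subsetP SQ B BS).
  by apply/set0Pn; exists x; apply/bigcupP; exists B.
by have := forest c0; have := card_edges_cover SQ; lia.
Qed.

Lemma outer_card : #|outer Q|.+1 = #|Q|.
Proof.
have := card_edges_cover (subxx Q); rewrite cover_Q (subLOT_card subT).
have -> : #|outer_in Q| = #|outer Q|; last by lia.
apply: eq_card => e; rewrite inE andb_idr // inE => /andP[eT _].
by rewrite (pblock_Q (edge_ends true eT)) (pblock_Q (edge_ends false eT)).
Qed.

Lemma outer_label e : e \in outer Q -> label_block Q e \in Q.
Proof. by rewrite inE => /andP[eT _]; apply/pblock_Q/subLOT_label. Qed.

Lemma outer_end b e : e \in outer Q -> pblock Q (endp b e) \in Q.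
Proof. by rewrite inE => /andP[eT _]; apply/pblock_Q/edge_ends. Qed.

(** The edges inside a block use up all of its vertices but one as labels, so by injectivity of
    labels only one vertex is left to label an outer edge. *)
Lemma label_block_inj : {in outer Q &, injective (label_block Q)}.
Proof.
move=> e1 e2 o1 o2 e12; set B := label_block Q e1 in e12.
have BQ : B \in Q by apply: outer_label.
have inB e : e \in outer Q -> label_block Q e = B -> label e \in B :\: (@label G @: edges_in g B).
  move=> oe eB; have eT : e \in edges_in g T by move: oe; rewrite inE => /andP[].
  rewrite inE -{2}eB mem_pblock cover_Q (subLOT_label subT) // andbT.
  rewrite (mem_imset _ _ label_inj) edges_in_block // eT /=.
  move: oe; rewrite inE eT /=; apply: contra => /andP[/eqP-> /eqP->].
  exact: eqxx.
have c1 : #|B :\: (@label G @: edges_in g B)| = 1%N.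
  have sB := block_subLOT BQ; rewrite cardsD (setIidPr _); last first.
    by apply/subsetP=> _ /imsetP[e eB ->]; apply: subLOT_label eB.
  by rewrite (subLOT_card sB) card_imset // subSnn.
have /cards1P[x xE] : #|B :\: (@label G @: edges_in g B)| == 1%N by apply/eqP.
apply: label_inj; have := inB e1 o1 erefl; have := inB e2 o2 (esym e12).
by rewrite xE !inE => /eqP-> /eqP->.
Qed.

Lemma root_block : exists2 r, r \in Q & label_block Q @: outer Q = Q :\ r.
Proof.
have sub : label_block Q @: outer Q \subset Q.
  by apply/subsetP=> _ /imsetP[e oe ->]; apply: outer_label.
have : #|Q :\: label_block Q @: outer Q| == 1%N.
  by rewrite cardsD (setIidPr sub) (card_in_imset label_block_inj) -outer_card subSnn.
case/cards1P=> r rE; exists r.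
  have : r \in Q :\: label_block Q @: outer Q by rewrite rE inE.
  by rewrite inE => /andP[].
by rewrite -rE setDDr setDv set0U (setIidPr sub).
Qed.

Hypothesis Qmin : forall Q', subLOT_partition Q' -> (1 < #|Q'|)%N -> (#|Q| <= #|Q'|)%N.

(** Otherwise the union of [S] would be a sub-LOT, and merging it into one block would give a
    smaller partition that still has two blocks. *)
Lemma no_merge (S : {set {set V}}) : S \proper Q -> (1 < #|S|)%N -> #|outer_in S|.+1 = #|S| ->
  ~ (forall e, e \in outer_in S -> label_block Q e \in S).
Proof.
move=> /andP[SQ nQS] S2 cS labS.
have S0 : S != set0 by rewrite -card_gt0 ltnW.
have sL : subLOT (cover S).
  apply/and3P; split.
  - have /set0Pn[B BS] := S0; have /and3P[/set0Pn[x xB] _ _] := block_subLOT (subsetP SQ B BS).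
    by apply/set0Pn; exists x; apply/bigcupP; exists B.
  - apply/forall_inP=> e; rewrite edges_in_cover // => /and3P[eT e1 e2].
    rewrite mem_cover_sub ?(subLOT_label subT) //.
    case: (eqVneq (pblock Q (src g e)) (pblock Q (tgt g e))) => e12; last first.
      by apply: labS; rewrite inE e1 e2 inE eT e12.
    have BQ := subsetP SQ _ e1.
    have eB : e \in edges_in g (pblock Q (src g e)) by rewrite edges_in_block // eT -e12 eqxx.
    by rewrite (def_pblock triv_Q BQ (subLOT_label (block_subLOT BQ) eB)).
  by apply/eqP; have := card_edges_cover SQ; lia.
have cQ : #|Q :\: S| = (#|Q| - #|S|)%N by rewrite cardsD (setIidPr SQ).
have DS : (0 < #|Q :\: S|)%N by rewrite card_gt0 setD_eq0.
have disj B : B \in Q :\: S -> [disjoint cover S & B].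
  rewrite inE => /andP[BS BQ]; rewrite -setI_eq0; apply/eqP/setP=> x; rewrite !inE.
  apply: contraNF BS => /andP[xS xB].
  by rewrite -(def_pblock triv_Q BQ xB) -mem_cover_sub // -cover_Q; apply/bigcupP; exists B.
have nin : cover S \notin Q :\: S.
  apply/negP=> /disj; rewrite -setI_eq0 setIid.
  by case/and3P: sL => /negbTE->.
have : (#|cover S |: (Q :\: S)| < #|Q|)%N by rewrite cardsU1 nin cQ; lia.
rewrite ltnNge Qmin //; last by rewrite cardsU1 nin; lia.
have QD B : B \in Q :\: S -> B \in Q by rewrite inE => /andP[].
apply/andP; split; last first.
  by apply/forall_inP=> B; rewrite in_setU1 => /orP[/eqP->|/QD/block_subLOT].
apply/and3P; split.
- rewrite -cover_Q eqEsubset; apply/andP; split; apply/subsetP=> x.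
    case/bigcupP=> B; rewrite in_setU1 => /orP[/eqP-> xS|/QD BQ xB].
      by rewrite cover_Q; apply: subsetP (cover_sub SQ) _ xS.
    by apply/bigcupP; exists B.
  case/bigcupP=> B BQ xB; case: (boolP (B \in S)) => BS; apply/bigcupP.
    by exists (cover S); [rewrite in_setU1 eqxx | apply/bigcupP; exists B].
  by exists B; rewrite // !inE BS BQ orbT.
- apply/trivIsetP=> A B; rewrite !in_setU1 => /orP[/eqP->|AD] /orP[/eqP->|BD] AB.
  + by rewrite eqxx in AB.
  + exact: disj.
  + by rewrite disjoint_sym; apply: disj.
  by apply: (trivIsetP triv_Q); rewrite ?QD.
rewrite in_setU1 negb_or eq_sym; apply/andP; split; first by case/and3P: sL.
by apply/negP=> /QD/block_subLOT/and3P[/eqP].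
Qed.

(** There are exactly [#|S|] outer edges labelled in [S]. If at most one arc leaves [S], all but one
    of them lie inside [S]; these then form a tree on [S] with labels in [S], which [no_merge]
    excludes. *)
Lemma outer_cut (r : {set V}) (S : {set {set V}}) :
  (2 < #|Q|)%N -> r \in Q -> label_block Q @: outer Q = Q :\ r ->
  S != set0 -> S \subset Q :\ r ->
  (1 < #|[set x : E * bool | [&& x.1 \in outer Q, label_block Q x.1 \in S &
                               pblock Q (endp x.2 x.1) \notin S]]|)%N.
Proof.
move=> Q3 rQ rE S0 Sr; rewrite ltnNge; set C := [set _ | _]; apply/negP=> C1.
have SQ : S \subset Q by apply: subset_trans Sr (subsetDl _ _).
have SpQ : S \proper Q.
  by rewrite properE SQ; apply/subsetPn; exists r => //; apply/negP=> /(subsetP Sr); rewrite !inE eqxx.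
pose OS := [set e in outer Q | label_block Q e \in S].
have cOS : #|OS| = #|S|.
  have SE : S = label_block Q @: OS.
    apply/setP=> B; apply/idP/imsetP => [BS|[e + ->]]; last by rewrite inE => /andP[].
    have := subsetP Sr B BS; rewrite -rE => /imsetP[e oe Be].
    by exists e; rewrite // inE oe -Be.
  rewrite [in RHS]SE card_in_imset // => e1 e2.
  by rewrite inE => /andP[o1 _]; rewrite inE => /andP[o2 _]; apply: label_block_inj.
have cout : (#|OS :\: outer_in S| <= #|C|)%N.
  apply: leq_trans (leq_imset_card (fun x : E * bool => x.1) C); apply: subset_leq_card.
  apply/subsetP=> e; rewrite inE => /andP[+ eOS].
  move: eOS; rewrite inE => /andP[oe eS]; rewrite inE oe /= negb_and.
  case/orP=> ne; apply/imsetP; [exists (e, true) | exists (e, false)] => //;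
    by rewrite inE /= oe eS.
have cin := outer_in_card SQ S0.
have cI : (#|OS :&: outer_in S| <= #|outer_in S|)%N by apply: subset_leq_card; apply: subsetIr.
have cOS' := cardsID (outer_in S) OS.
have IE : OS :&: outer_in S = outer_in S.
  by apply/eqP; rewrite eqEcard subsetIr /=; lia.
have cin1 : #|outer_in S|.+1 = #|S| by rewrite IE in cOS'; lia.
have [S2|S1] := ltnP 1 #|S|.
  by apply: (no_merge SpQ S2 cin1) => e; rewrite -IE inE => /andP[+ _]; rewrite inE => /andP[].
(* A single block cannot be merged with itself. Instead, its edge [e] has one end in it, so it
   merges with the block [B'] of the other end; as there are more than two blocks, this pair is
   proper. *)
have [B SB] : exists B, S = [set B] by apply/cards1P; rewrite eqn_leq S1 card_gt0.
have [e OSe] : exists e, OS = [set e] by apply/cards1P; rewrite cOS eqn_leq S1 card_gt0.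
have : e \in OS by rewrite OSe inE.
rewrite inE => /andP[oe]; rewrite SB inE => /eqP eB.
have nin : e \notin outer_in S.
  have : #|outer_in S| == 0%N by lia.
  by rewrite cards_eq0 => /eqP->; rewrite inE.
have [b hb] : exists b, pblock Q (endp b e) == B.
  apply/existsP; apply: contraLR C1 => /existsPn nb; rewrite -ltnNge.
  have <- : #|[set (e, true); (e, false)]| = 2%N by rewrite cards2 xpair_eqE eqxx.
  apply: subset_leq_card; apply/subsetP=> x; rewrite in_set2.
  by case/orP=> /eqP->; rewrite inE /= oe SB !in_set1 eB eqxx ?(nb true) ?(nb false).
pose B' := pblock Q (endp (~~ b) e).
have BB' : B != B'.
  have : pblock Q (src g e) != pblock Q (tgt g e) by move: oe; rewrite inE => /andP[].
  by rewrite -(eqP hb) /B'; case: (b) => //=; rewrite eq_sym.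
have B'Q : B' \in Q by apply: outer_end.
have BQ : B \in Q by apply: (subsetP SQ); rewrite SB inE.
have sQ : [set B; B'] \subset Q by apply/subsetP=> X; rewrite !inE => /orP[] /eqP->.
have c2 : #|[set B; B']| = 2%N by rewrite cards2 BB'.
have ein : e \in outer_in [set B; B'].
  rewrite inE oe !inE /B' -(eqP hb).
  by case: (b) => /=; rewrite !eqxx ?orbT.
have i1 : (#|outer_in [set B; B']| < #|[set B; B']|)%N.
  by apply: outer_in_card; rewrite // -card_gt0 c2.
have oi : outer_in [set B; B'] = [set e].
  by apply/esym/eqP; rewrite eqEcard sub1set ein cards1; move: i1; rewrite c2.
apply: (@no_merge [set B; B']).
- rewrite properEneq sQ andbT; apply: contraTneq Q3 => <-.
  by rewrite c2.
- by rewrite c2.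
- by rewrite oi cards1 c2.
by move=> e'; rewrite oi inE => /eqP->; rewrite eB !inE eqxx.
Qed.

End Blocks.

Lemma singletons_partition : subLOT_partition [set [set x] | x in T].
Proof.
apply/andP; split.
  apply/and3P; split.
  - rewrite eqEsubset; apply/andP; split; apply/subsetP=> x.
      by case/bigcupP=> _ /imsetP[y yT ->]; rewrite inE => /eqP->.
    by move=> xT; apply/bigcupP; exists [set x]; rewrite ?imset_f ?inE.
  - apply/trivIsetP=> _ _ /imsetP[x _ ->] /imsetP[y _ ->].
    rewrite (inj_eq set1_inj) => xy; rewrite disjoints1 inE.
    by rewrite xy.
  by apply/imsetP=> -[x _ /setP/(_ x)]; rewrite !inE eqxx.
apply/forall_inP=> _ /imsetP[x _ ->].
have x0 : [set x] != set0 by apply/set0Pn; exists x; rewrite inE.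
have := forest x0; rewrite cards1 ltnS leqn0 => /eqP e0.
rewrite /subLOT x0 e0 cards1 andbT /=; apply/forall_inP=> e.
by move/eqP: e0; rewrite cards_eq0 => /eqP->; rewrite in_set0.
Qed.

Lemma lot_partition : (1 < #|T|)%N ->
  exists Q, [/\ subLOT_partition Q, (1 < #|Q|)%N &
    (exists e b, [/\ outer Q = [set e], pblock Q (endp b e) != label_block Q e
                   & pblock Q (endp (~~ b) e) = label_block Q e])
    \/ (exists (sg : {set V} -> bool) (dep : bool -> {set V} -> nat),
        forall e eps, e \in outer Q ->
          (dep eps (pblock Q (endp (sg (label_block Q e) (+) eps) e))
            < dep eps (label_block Q e))%N)].
Proof.
move=> T2; pose P Q := subLOT_partition Q && (1 < #|Q|)%N.
have P1 : P [set [set x] | x in T].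
  by rewrite /P singletons_partition card_imset //; apply: set1_inj.
have [Q /andP[QT Q2] Qmin0] := arg_minnP (fun Q : {set {set V}} => #|Q|) P1.
have Qmin Q' : subLOT_partition Q' -> (1 < #|Q'|)%N -> (#|Q| <= #|Q'|)%N.
  by move=> h1 h2; apply: Qmin0; rewrite /P h1.
exists Q; split=> //; have [Q3|Q3] := ltnP 2 #|Q|; [right | left].
  have [r rQ rE] := root_block QT.
  apply: (@two_arborescences _ _ Q (outer Q) r (label_block Q) (fun b e => pblock Q (endp b e))).
  - exact: rQ.
  - exact: label_block_inj.
  - by move=> e oe; rewrite -rE imset_f.
  - by move=> e b; apply: outer_end.
  by move=> S S0 Sr; apply: (outer_cut QT Qmin Q3 rQ rE S0 Sr).
have /cards1P[e oE] : #|outer Q| == 1%N by have := outer_card QT; lia.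
have oe : e \in outer Q by rewrite oE inE.
have st : pblock Q (src g e) != pblock Q (tgt g e) by move: oe; rewrite inE => /andP[].
have sQ := outer_end QT true oe; have tQ := outer_end QT false oe; have lQ := outer_label QT oe.
have : label_block Q e \in [set pblock Q (src g e); pblock Q (tgt g e)].
  suff -> : [set pblock Q (src g e); pblock Q (tgt g e)] = Q by [].
  apply/eqP; rewrite eqEcard cards2 st /= Q3 andbT; apply/subsetP=> X.
  by rewrite !inE => /orP[] /eqP->.
rewrite in_set2 => /orP[] /eqP lE; exists e; [exists false | exists true]; rewrite lE //=.
by rewrite eq_sym.
Qed.

End Partition.

(** * Diagrams over a LOT-complex *)

(** A closed path that changes sides must change back. *)
Lemma porbit_cross_back (D : finType) (s : {perm D}) (z : pred D) a : z a != z (s a) ->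
  exists b, [/\ b \in porbit s a, z b = z (s a) & z (s b) = z a].
Proof.
move=> za; have /existsP[b /and3P[b1 /eqP b2 /eqP b3]] :
    [exists b, [&& b \in porbit s a, z b == z (s a) & z (s b) == z a]].
  apply: contraT => /existsPn H; suff /eqP e : z a == z (s a) by rewrite e eqxx in za.
  have : (z a == z (s a)) && (a \in porbit s a).
    apply: (porbit_iter_ind (s := s) (a := s a)
      (P := fun x => (z x == z (s a)) && (x \in porbit s a))).
    - move=> x /andP[zx xa]; rewrite mem_porbit_step xa andbT.
      by have := H x; rewrite xa zx /=; move: za; case: (z (s x)) (z a) (z (s a)) => [] [] [].
    - by rewrite eqxx mem_porbit_step porbit_id.
    by rewrite porbit_stepE porbit_id.
  by case/andP.
by exists b.
Qed.

Section Diagram.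
Variables (G : LOG) (C : sphere) (f : diagram C (LOG_complex G)).
Local Notation D := (dart C).
Local Notation v := (vnext C).
Local Notation fn := (fnext C).
Local Notation op := (opp C).
Local Notation V := (lvert G).
Local Notation E := (ledge G).
Local Notation L := (LOG_complex G).

Definition gen (a : D) : V := (dedge f a).1.
Definition sgn (a : D) : bool := (dedge f a).2.

(* In the link, the corner at [a] joins an endpoint of the edge [ce a] of the LOT, with sign
   [cs a], to its label, with sign [cb a]; the endpoint is the source if [cb a] and the target
   otherwise, and [cd a] says that the corner runs from the endpoint to the label. *)
Definition pos_of (s : side L) : nat := tagged s.
Definition ce (a : D) : E := tag (dcorner f a).1.
Definition cb (a : D) : bool := (pos_of (dcorner f a).1 < 2)%N.
Definition cs (a : D) : bool := pos_of (dcorner f a).1 \in [:: 0; 3]%N.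
Definition cd (a : D) : bool := odd (pos_of (dcorner f a).1) != (dcorner f a).2.

(** For a cell with word [x z y^-1 z^-1] the corners 0 to 3 run in the link from [x+] to [z+], [z+]
    to [x-], [y-] to [z-], and [z-] to [y+]. *)
Lemma corner_ends (s : side L) (k := pos_of s) (x := (endp (k < 2)%N (tag s), k \in [:: 0; 3]%N))
    (z := (label (tag s), (k < 2)%N)) :
  (letter s, ebar (letter (side_pred s))) = if odd k then (z, x) else (x, z).
Proof.
rewrite /x /z /k {x z k}; case: s => e [k lt]; rewrite /pos_of /letter /=.
rewrite !(tnth_nth (src (lgraph G) e, true)) /=.
by case: k lt => [|[|[|[|]]]].
Qed.

Lemma dart_ends a : (dedge f a, dedge f (v a)) =
  if cd a then ((endp (cb a) (ce a), cs a), (label (ce a), cb a))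
  else ((label (ce a), cb a), (endp (cb a) (ce a), cs a)).
Proof.
rewrite -lk_src_dcorner -lk_tgt_dcorner /cd /cb /cs /ce /lk_tgt /lk_src.
case: (dcorner f a) => s [] /=; have := corner_ends s.
  by rewrite /= => ->; case: (odd _).
by move/(congr1 (fun p => (p.2, p.1))) => /= ->; case: (odd _).
Qed.

Lemma corner_opposite a b :
  ce a = ce b -> cb a = cb b -> cs a = cs b -> cd a != cd b -> dcorner f a = cbar (dcorner f b).
Proof.
rewrite /ce /cb /cs /cd /cbar; case: (dcorner f a) => [[e i] d]; case: (dcorner f b) => [[e' i'] d'].
rewrite /pos_of /= => ee; case: _ / ee i' => i' h1 h2 h3.
have ii : i = i'.
  apply: ord_inj; move: i i' h1 h2 {h3} => [i hi] [i' hi'] /=.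
  by case: i hi => [|[|[|[|]]]]; case: i' hi' => [|[|[|[|]]]].
suff -> : d = ~~ d' by rewrite ii.
by move: h3; rewrite ii; case: (odd i') d d' => [] [] [].
Qed.

Lemma dcorner_fnext a : dcorner f (fn a) =
  ((if (dcorner f a).2 then side_succ (dcorner f a).1 else side_pred (dcorner f a).1),
   (dcorner f a).2).
Proof.
rewrite /dcorner dsign_next dside_next; case: (dsign f a) => //=.
by rewrite side_predK side_succK.
Qed.

Lemma ce_fnext a : ce (fn a) = ce a.
Proof. by rewrite /ce dcorner_fnext; case: ifP. Qed.

Lemma corner_fnext a :
  [/\ cd (fn a) = ~~ cd a, cb (fn a) = cb a (+) ~~ cd a & cs (fn a) = cs a (+) cd a].
Proof.
rewrite /cd /cb /cs !dcorner_fnext; case: (dcorner f a) => [[e [i hi]] d] /=.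
by case: d => /=; rewrite /pos_of /=; case: i hi => [|[|[|[|]]]].
Qed.

Lemma face_size a : #|porbit fn a| = 4%N.
Proof. exact: (dface_size f a). Qed.

Lemma sgn_opp a : sgn (op a) = ~~ sgn a.
Proof. by rewrite /sgn dedge_opp. Qed.

Lemma gen_opp a : gen (op a) = gen a.
Proof. by rewrite /gen dedge_opp. Qed.

Lemma genE a : gen a = if cd a then endp (cb a) (ce a) else label (ce a).
Proof.
by rewrite /gen -[dedge f a]/(dedge f a, dedge f (v a)).1 dart_ends; case: (cd a).
Qed.

Lemma gen_vnext a : gen (v a) = if cd a then label (ce a) else endp (cb a) (ce a).
Proof.
by rewrite /gen -[dedge f (v a)]/(dedge f a, dedge f (v a)).2 dart_ends; case: (cd a).
Qed.

Lemma sgnE a : sgn a = if cd a then cs a else cb a.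
Proof.
by rewrite /sgn -[dedge f a]/(dedge f a, dedge f (v a)).1 dart_ends; case: (cd a).
Qed.

Lemma sgn_vnext a : sgn (v a) = if cd a then cb a else cs a.
Proof.
by rewrite /sgn -[dedge f (v a)]/(dedge f a, dedge f (v a)).2 dart_ends; case: (cd a).
Qed.

Lemma sgn_fnext2 a : sgn (fn (fn a)) = ~~ sgn a.
Proof.
rewrite !sgnE; have [-> -> ->] := corner_fnext (fn a); have [-> -> ->] := corner_fnext a.
by case: (cd a); case: (cb a); case: (cs a).
Qed.

(** Opposite sides of each square are traversed with opposite signs, so the signs sum to 0 around
    every face. *)
Lemma height_exists :
  exists h : D -> rat, forall a, h (v a) = h a /\ h (op a) = h a + (if sgn a then 1 else -1).
Proof.
have [||h H] := @sphere_exact C sgn sgn_opp (fun a => if sgn a then 1 else -1).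
- by move=> a; rewrite sgn_opp; case: (sgn a); rewrite ?opprK.
- move=> X XF; set S := \sum_(a in X) _.
  have : S = - S.
    rewrite -sumrN /S (reindex_inj (@perm_inj _ (fn * fn)%g)) /=.
    apply: eq_big => [a|a _]; first by rewrite permM !porbits_stepE.
    by rewrite permM sgn_fnext2; case: (sgn a); rewrite ?opprK.
  by move=> H; lra.
by exists h => a; have [-> H2] := H a; split=> //; rewrite -H2; ring.
Qed.

Hypothesis no_fold : forall a b, b \in porbit v a -> dcorner f a <> cbar (dcorner f b).

Lemma same_direction a b : b \in porbit v a -> ce a = ce b -> cb a = cb b -> cs a = cs b ->
  cd a = cd b.
Proof.
move=> ab e1 e2 e3; case: (eqVneq (cd a) (cd b)) => // d.
by case: (no_fold ab); apply: corner_opposite.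
Qed.

(** * Inner and outer cells relative to a partition *)

Section Blocks.
Variables (T : {set V}) (Q : {set {set V}}).
Hypothesis label_inj : injective (@label G).
Hypothesis subT : subLOT T.
Hypothesis QT : subLOT_partition T Q.
Hypothesis ceT : forall a, ce a \in edges_in (lgraph G) T.

Definition cl a := pblock Q (gen a).
Definition inn a := pblock Q (src (lgraph G) (ce a)) == pblock Q (tgt (lgraph G) (ce a)).
Definition lbl a := label_block Q (ce a).
Definition ecl a := pblock Q (endp (cb a) (ce a)).

Lemma out_outer a : ~~ inn a -> ce a \in outer T Q.
Proof. by move=> na; rewrite inE ceT. Qed.

Lemma inn_fnext a : inn (fn a) = inn a.
Proof. by rewrite /inn ce_fnext. Qed.

Lemma clE a : cl a = if cd a then ecl a else lbl a.
Proof. by rewrite /cl genE; case: (cd a). Qed.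

Lemma cl_vnextE a : cl (v a) = if cd a then lbl a else ecl a.
Proof. by rewrite /cl gen_vnext; case: (cd a). Qed.

Lemma inn_lbl a b : inn a -> pblock Q (endp b (ce a)) = lbl a.
Proof.
move=> ia; have BQ := pblock_Q QT (edge_ends b (ceT a)).
have eB : ce a \in edges_in (lgraph G) (pblock Q (endp b (ce a))).
  rewrite (edges_in_block QT) // ceT /=; move/eqP: ia => ia.
  by case: b {BQ} => /=; rewrite ?ia eqxx.
by rewrite /lbl /label_block (def_pblock (triv_Q QT) BQ (subLOT_label (block_subLOT QT BQ) eB)).
Qed.

Lemma inn_cl a : inn a -> cl (v a) = cl a.
Proof. by move=> ia; rewrite (clE a) cl_vnextE /ecl inn_lbl // if_same. Qed.

(** The block of the generator does not change across an inner corner, so it is constant on the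
    connected sphere. *)
Lemma all_inn_block : (forall a, inn a) -> exists2 B, B \in Q & forall a, ce a \in edges_in (lgraph G) B.
Proof.
move=> ai; have [d _] := sphere_dart C; exists (cl d).
  rewrite clE /ecl /lbl; case: (cd d); first exact/(pblock_Q QT)/edge_ends/ceT.
  exact/(pblock_Q QT)/(subLOT_label subT)/ceT.
have Ho a : cl (op a) = cl a by rewrite /cl gen_opp.
have Hf a : cl (fn a) = cl a by rewrite -(inn_cl (ai (fn a))) vnext_fnext Ho.
have Hd a : cl a = cl d.
  by apply/eqP; apply: (@sphere_all C (fun a => cl a == cl d) _ _ d) => // b; rewrite ?Ho ?Hf.
have la a : lbl a = cl d.
  by rewrite -(Hd a) clE /ecl inn_lbl // if_same.
have dQ : cl d \in Q by rewrite -(la d); apply/(pblock_Q QT)/(subLOT_label subT)/ceT.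
move=> a; rewrite (edges_in_block QT) // ceT /= -(la a).
by rewrite (inn_lbl true (ai a)) (inn_lbl false (ai a)) eqxx.
Qed.

Lemma single_outer_edge e b : outer T Q = [set e] -> pblock Q (endp b e) != label_block Q e ->
  pblock Q (endp (~~ b) e) = label_block Q e -> forall a, inn a.
Proof.
move=> oE eb enb; have [h H] := height_exists.
have ceE a : ~~ inn a -> ce a = e by move/out_outer; rewrite oE inE => /eqP.
(* By [zcr] these are exactly the corners at which the link passes between the two blocks; a highest
   one is chosen. *)
pose cr a := ~~ inn a && (cb a == b).
pose z a := cl a == label_block Q e.
have lblE a : ~~ inn a -> lbl a = label_block Q e by move/ceE => ea; rewrite /lbl ea.
have zE a : ~~ inn a -> z a = (if cd a then cb a != b else true) /\ 
     z (v a) = (if cd a then true else cb a != b).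
  move=> na; rewrite /z clE cl_vnextE lblE // /ecl ceE //.
  have E1 : (pblock Q (endp (cb a) e) == label_block Q e) = (cb a != b).
    case: (eqVneq (cb a) b) => [->|ne]; first exact/negbTE.
    by rewrite -enb; move: ne; case: (cb a) (b) => [] []; rewrite ?eqxx.
  by case: (cd a); rewrite ?E1 eqxx.
have zcr a : cr a = (z a != z (v a)).
  case: (boolP (inn a)) => ia; first by rewrite /cr ia /z inn_cl ?eqxx.
  by have [-> ->] := zE a ia; rewrite /cr ia; case: (cd a); case: (_ == b).
have nocr a : ~~ cr a.
  apply/negP=> ca0; case: (@arg_maxP _ _ _ a cr h ca0) => {ca0}a ca amax.
  have hv x : x \in porbit v a -> h x = h a.
    move=> xa; apply/eqP; apply: (porbit_iter_ind (s := v) (P := fun x => h x == h a) _ _ xa) => // y.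
    by have [->] := H y.
  (* If the endpoint edge of [x] went up, the corner of the same cell at its upper end would be a
     higher crossing. *)
  have nup x : x \in porbit v a -> cr x -> cs x = false.
    move=> xa cx; apply/negP=> sx; have /andP[nx /eqP bx] := cx.
    have up y : cr y -> h a < h y -> False by move=> cy lt; have := amax y cy; rewrite /= leNgt lt.
    case: (boolP (cd x)) => dx.
      apply: (up (fn x)).
        rewrite /cr inn_fnext nx /=.
        by have [_ -> _] := corner_fnext x; rewrite dx addbF bx.
      have [<- _] := H (fn x); rewrite vnext_fnext; have [_ ->] := H x.
      by rewrite sgnE dx sx hv // ltrDl.
    have [y xy vx] := vnextE x.
    have [dy by' _] := corner_fnext y; rewrite -xy in dy by'.
    have cdy : cd y by move: dx; rewrite dy negbK.
    apply: (up y).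
      by rewrite /cr -inn_fnext -xy nx /= -bx by' cdy addbF.
    rewrite -[y](oppK) -vx; have [_ ->] := H (v x); have [-> _] := H x.
    by rewrite sgn_vnext (negbTE dx) sx hv // ltrDl.
  (* The link path crosses back at a corner with the same edge, end and sign as [a] but in the
     opposite direction: a fold. *)
  have [x [xa zx1 zx2]] : exists x, [/\ x \in porbit v a, z x = z (v a) & z (v x) = z a].
    by apply: porbit_cross_back; rewrite -zcr.
  have cx : cr x by rewrite zcr zx1 zx2 eq_sym -zcr.
  have /andP[na /eqP ba] := ca; have /andP[nx /eqP bx] := cx.
  have d : cd a = cd x.
    apply: (same_direction xa); rewrite ?ba ?bx ?(ceE a) ?(ceE x) //.
    by rewrite (nup a (porbit_id v a) ca) (nup x xa cx).
  move: zx1; have [-> _] := zE x nx; have [_ ->] := zE a na.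
  by rewrite d ba bx eqxx; case: (cd x).
move=> a; apply: contraT => na; have [_ b1 _] := corner_fnext a; have [d2 b2 _] := corner_fnext (fn a).
have [d1 _ _] := corner_fnext a.
have := nocr a; have := nocr (fn (fn a)); rewrite /cr !inn_fnext na /= b2 b1 d1.
by case: (cb a) (cd a) b {eb enb cr zE zcr nocr} => [] [] [].
Qed.

(** Verifies the hypotheses of [outer_contradiction] for the colour given by the sign of an edge
    times the sign [sg] of its block. *)
Lemma no_outer_cells (sg : {set V} -> bool) (dep : bool -> {set V} -> nat) :
  (forall e eps, e \in outer T Q ->
     (dep eps (pblock Q (endp (sg (label_block Q e) (+) eps) e)) < dep eps (label_block Q e))%N) ->
  forall a, inn a.
Proof.
move=> Hdep o; apply: contraT => no; exfalso.
have [h H] := height_exists.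
pose col a := sgn a (+) sg (cl a).
apply: (@outer_contradiction C sgn inn col o h sgn_opp inn_fnext no) => //.
- by move=> a; have [] := H a.
- by move=> a sa; have [_ ->] := H a; rewrite sa ltrDl.
- exact: face_size.
- by move=> a ia; rewrite /col inn_cl //; case: (sgn a); case: (sgn (v a)); case: (sg _).
(* The involution [p] exchanges the two corners at the ends of an endpoint side. It changes only the
   sign [cs] there, so exactly one corner of each pair is bichromatic. *)
- pose p a := if cd a then fn a else (fn^-1)%g a.
  have cdV a : cd ((fn^-1)%g a) = ~~ cd a.
    by rewrite -[in RHS](permKV fn a); have [-> _ _] := corner_fnext ((fn^-1)%g a); rewrite negbK.
  have pK : involutive p.
    move=> a; rewrite /p; case: (boolP (cd a)) => da.
      by have [-> _ _] := corner_fnext a; rewrite da /= permK.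
    by rewrite cdV da permKV.
  have pE a : [/\ ce (p a) = ce a, cb (p a) = cb a & cs (p a) = ~~ cs a].
    rewrite /p; case: (boolP (cd a)) => da.
      by rewrite ce_fnext; have [_ -> ->] := corner_fnext a; rewrite da addbF addbT.
    have := cdV a; rewrite da; move: (permKV fn a); set b := (fn^-1)%g a => <- db.
    by rewrite ce_fnext; have [_ -> ->] := corner_fnext b; rewrite db addbF addbT negbK.
  pose M := [set a | ~~ inn a && (col a != col (v a))].
  have mixE a : (col a != col (v a)) = (cs a (+) cb a) (+) (sg (ecl a) (+) sg (lbl a)).
    rewrite /col sgnE sgn_vnext clE cl_vnextE.
    by case: (cd a); case: (cs a); case: (cb a); case: (sg (ecl a)); case: (sg (lbl a)).
  have mixp a : (col (p a) != col (v (p a))) = ~~ (col a != col (v a)).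
    rewrite !mixE /ecl /lbl; have [-> -> ->] := pE a.
    by case: (cs a); case: (cb a); case: (sg _) => /=; case: (sg _).
  rewrite mul2n -addnn -(cardsID [set a | col a != col (v a)] [set a | ~~ inn a]).
  congr (_ + _)%N; first by apply: eq_card => a; rewrite !inE.
  rewrite -(card_imset _ (inv_inj pK)); apply: eq_card => a.
  have innp : inn (p a) = inn a by rewrite /inn; have [-> _ _] := pE a.
  by rewrite -{1}[a]pK (mem_imset _ _ (inv_inj pK)) !inE mixp innp andbC.
move=> a0 e na0 mono.
pose P b := (b \in porbit v a0) && ~~ inn b.
have Pa0 : P a0 by rewrite /P porbit_id.
(* If all outer corners here have colour [e], each runs along an arc of the arborescence [e],
   between a label block and a block of smaller depth. The chosen one has the deepest label
   block. *)
case: (arg_maxnP (fun b => dep e (lbl b)) Pa0) => a /andP[aX na] amax.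
have col_lbl x : x \in porbit v a0 -> ~~ inn x -> cb x = sg (lbl x) (+) e /\ cs x = sg (ecl x) (+) e.
  move=> xX nx; have := mono x xX nx; rewrite /col sgnE sgn_vnext clE cl_vnextE.
  by case: (cd x) => -[<- eq]; move: eq; case: (cs x); case: (cb x); case: (sg (ecl x)); case: (sg (lbl x)).
have lt x : x \in porbit v a0 -> ~~ inn x -> (dep e (ecl x) < dep e (lbl x))%N.
  move=> xX nx; have := Hdep _ e (out_outer nx).
  by rewrite -/(lbl x); have [<- _] := col_lbl x xX nx.
pose z x := cl x == lbl a.
have ne x : x \in porbit v a0 -> ~~ inn x -> (ecl x == lbl a) = false.
  move=> xX nx; apply/eqP=> eE; have := lt x xX nx; rewrite eE ltnNge.
  by have := amax x; rewrite /P xX nx /= => /(_ isT) ->.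
have zE x : x \in porbit v a0 -> ~~ inn x ->
    z x = ~~ cd x && (lbl x == lbl a) /\ z (v x) = cd x && (lbl x == lbl a).
  by move=> xX nx; rewrite /z clE cl_vnextE; case: (cd x); rewrite ?ne.
have za : z a != z (v a) by have [-> ->] := zE a aX na; rewrite eqxx; case: (cd a).
(* The link path must cross the border of the deepest block again in the other direction. By
   maximality that block is again the label block, so the corner comes from the same edge and is
   opposite to [a]. *)
have [b [ba zb1 zb2]] := porbit_cross_back za.
have bX : b \in porbit v a0.
  by move: aX; rewrite -eq_porbit_mem => /eqP <-.
have nb : ~~ inn b.
  by apply: contra za => ib; rewrite -zb1 -zb2 /z inn_cl.
have lE : lbl b = lbl a.
  apply/eqP; move: zb1 zb2 za; have [-> ->] := zE b bX nb.
  by case: (lbl b == lbl a) => //; rewrite !andbF => <- <-.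
have eE : ce b = ce a by apply: (label_block_inj label_inj subT QT) lE; apply: out_outer.
have [b1 s1] := col_lbl b bX nb; have [b2 s2] := col_lbl a aX na.
have bE : cb a = cb b by rewrite b1 b2 lE.
have sE : cs a = cs b by rewrite s1 s2 /ecl bE eE.
have d := same_direction ba (esym eE) bE sE.
move: zb1; have [-> _] := zE b bX nb; have [_ ->] := zE a aX na.
by rewrite d lE eqxx; case: (cd b).
Qed.

End Blocks.
End Diagram.

(** * Conclusion by minimality of the sub-LOT *)

Lemma folding_or_not (G : LOG) (C : sphere) (f : diagram C (LOG_complex G)) :
  (exists a, folding f a) \/
  (forall a b, b \in porbit (vnext C) a -> dcorner f a <> cbar (dcorner f b)).
Proof.
pose fold a b := (b \in porbit (vnext C) a) && (dcorner f a == cbar (dcorner f b)).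
case: (boolP [exists a, exists b, fold a b]) => [|/existsPn H].
  case/existsP=> a /existsP[b /andP[ab /eqP e]]; left; exists a => H.
  by apply: (H _ _ _ _ e); rewrite /link_path map_f // -porbit_traject ?porbit_id.
right=> a b ab e; have /existsPn/(_ b) := H a.
by rewrite /fold ab e eqxx.
Qed.

Theorem theorem4p1 (G : LOG) (hT : is_LOT G) (hc : compressed G)
    (hi : label_injective G) : vertex_aspherical (LOG_complex G).
Proof.
move=> C f; case: (folding_or_not f) => // no_fold; exfalso.
have [_ _ acyclic] := hT.
have forest := forest_card acyclic.
pose P T := subLOT T && [forall a, ce f a \in edges_in (lgraph G) T].
have P1 : P setT.
  by rewrite /P LOT_subLOT //; apply/forallP=> a; rewrite !inE.
have [T /andP[subT /forallP ceT] Tmin] := arg_minnP (fun T : {set lvert G} => #|T|) P1.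
have T2 : (1 < #|T|)%N.
  have [d _] := sphere_dart C.
  by rewrite (subLOT_card subT) ltnS; apply/card_gt0P; exists (ce f d).
have [Q [QT Q2 Qcases]] := lot_partition forest hi subT T2.
have all_inn a : inn f Q a.
  case: Qcases => [[e [b [oE eb enb]]]|[sg [dep Hdep]]].
    exact: (single_outer_edge no_fold QT ceT oE eb enb).
  exact: (no_outer_cells no_fold hi subT QT ceT Hdep).
have [B BQ ceB] := all_inn_block subT QT ceT all_inn.
have subB := block_subLOT QT BQ.
(* One block contains all cells, so it equals the minimal [T], leaving no room for a second
   block. *)
have : (#|T| <= #|B|)%N by apply: Tmin; rewrite /P subB; apply/forallP.
have BT : B \subset T by rewrite -(cover_Q QT); apply: (bigcup_sup B).
move=> le; have BE : B = T by apply/eqP; rewrite eqEcard BT.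
have /subsetPn[B' B'Q] : ~~ (Q \subset [set B]).
  by apply: contraL Q2 => /subset_leq_card; rewrite cards1 leqNgt.
rewrite inE => /negP; apply; apply/eqP.
have /and3P[/set0Pn[x xB'] _ _] := block_subLOT QT B'Q.
have xB : x \in B by rewrite BE -(cover_Q QT); apply/bigcupP; exists B'.
by rewrite -(def_pblock (triv_Q QT) B'Q xB') (def_pblock (triv_Q QT) BQ xB).
Qed.
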